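(* Let $A$ be a finitely generated abelian group. For any integer $k>0$ there exists a finite set of words $W\subset\{a,b\}^*$ (where $a\neq b$ are two symbols) such that the $k$-th homology group of its Insertion Chain Complex is $A$, that is, $H_k(\mathcal{C}^B_*[W])\cong A$.
   Context: Let $\Sigma$ be a finite alphabet (here $\Sigma=\{a,b\}$). $\Sigma^*$ is the set of finite words over $\Sigma$, $1$ denotes the empty word, $x[1]$ is the first symbol of a nonempty word $x$, and $[m]=\{1,\dots,m\}$. Blocks. For $m\ge 0$ an $m$-block is a formal expression $\sigma=x_0(1,a_1)x_1(1,a_2)\cdots x_{m-1}(1,a_m)x_m$ with $x_i\in\Sigma^*$, $a_i\in\Sigma$ (an element of $\Sigma^*\times E\times\Sigma^*\times\dots\times E\times\Sigma^*$ with $m$ factors $E=\{(1,a):a\in\Sigma\}$); $\dim\sigma=m$; $0$-blocks are words. Equivalence of $m$-blocks is defined recursively: $0$-blocks are equivalent iff equal as words; for $m\ge1$, writing $\sigma_i=\hat\sigma_i(1,a_i)x_i$ with $\hat\sigma_i$ an $(m-1)$-block, $a_i\in\Sigma$, $x_i\in\Sigma^*$, one has $\sigma_1\equiv\sigma_2$ iff $\hat\sigma_1a_1x_1\equiv\hat\sigma_2a_2x_2$ and $\hat\sigma_1x_1\equiv\hat\sigma_2x_2$. A block is in canonical form if for every $i=1,\dots,m$ the word $x_i$ is empty or $x_i[1]\ne a_i$; each equivalence class contains exactly one block in canonical form. Blocks are considered up to equivalence (''='' means equivalent). Sub-blocks and vertices. For disjoint $I^+,I^-\subset[m]$, $\sigma(I^+,I^-)=x_0\lambda_1x_1\cdots\lambda_mx_m$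 where $\lambda_i=a_i$ if $i\in I^+$, $\lambda_i=1$ if $i\in I^-$, and $\lambda_i=(1,a_i)$ otherwise; it is an $(m-|I^+|-|I^-|)$-block. For $I\subset[m]$, $v_I(\sigma)=\sigma(I,[m]\setminus I)\in\Sigma^*$, and $V(\sigma)=\{v_I(\sigma):I\subset[m]\}$. Validity. $\sigma$, with canonical form $x_0(1,a_1)x_1\cdots(1,a_m)x_m$, is valid if for every $i=1,\dots,m-1$ with $x_i=1$ one has $a_i\ne a_{i+1}$. Insertion Chain Complex. For $W\subset\Sigma^*$, let $\mathcal{C}^B[W]$ be the set of all valid blocks $\sigma$ with $V(\sigma)\subset W$. The chain complex $\mathcal{C}^B_*[W]$ has as $k$-th chain group the free abelian group on the $k$-dimensional elements of $\mathcal{C}^B[W]$, with boundary $\partial\sigma=\sum_{i=1}^m(-1)^{i+1}\left[\overline F_i(\sigma)-\underline F_i(\sigma)\right]$ for a valid $m$-block with $m\ge1$, where $\overline F_i(\sigma)=\sigma(\{i\},\emptyset)$, and $\underline F_i(\sigma)=\sigma(\emptyset,\{i\})$ if this is a valid block and $\underline F_i(\sigma)=0$ otherwise; $\partial=0$ on $0$-blocks. Homology has $\mathbb{Z}$ coefficients. *)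

(* Defs.v *)
From HB Require Import structures.
From mathcomp Require Import all_boot all_order all_algebra.
From mathcomp Require Import boolp classical_sets cardinality.
From mathcomp Require Import freeg.

Set Implicit Arguments.
Unset Strict Implicit.
Unset Printing Implicit Defensive.

Import GRing.Theory.

Local Open Scope quotient_scope.
Local Open Scope ring_scope.

Section Blocks.
Variable Sigma : finType.
Implicit Types (u v w x y : seq Sigma) (a b : Sigma).

(* [Ins s a x] is the block s (1,a) x; the nesting to the left is the
   decomposition on which the definition of equivalence recurses. *)
Inductive block : Type :=
| Word of seq Sigma
| Ins of block & Sigma & seq Sigma.

Implicit Types s t : block.

Fixpoint block_encode s : seq Sigma * seq (Sigma * seq Sigma) :=
  match s with
  | Word u => (u, [::])
  | Ins s a x => let p := block_encode s in (p.1, (a, x) :: p.2)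
  end.

Fixpoint block_decode u (l : seq (Sigma * seq Sigma)) : block :=
  if l is (a, x) :: l' then Ins (block_decode u l') a x else Word u.

Lemma block_encodeK :
  cancel block_encode (fun p => block_decode p.1 p.2).
Proof. by elim=> //= s /= ->. Qed.

HB.instance Definition _ := Choice.copy block (can_type block_encodeK).

Fixpoint dim s : nat := if s is Ins s' _ _ then (dim s').+1 else 0.

Definition block_cat s w : block :=
  match s with
  | Word u => Word (u ++ w)
  | Ins s' a x => Ins s' a (x ++ w)
  end.

Lemma dim_cat s w : dim (block_cat s w) = dim s.
Proof. by case: s. Qed.

(* The recursive definition of equivalence; the fuel [n] is the dimension.
   [block_equiv_word] and [block_equiv_ins] are the defining equations. *)
Fixpoint block_equiv_rec n s t : bool :=
  match n, s, t with
  | _, Word u, Word v => u == v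
  | n'.+1, Ins s' a x, Ins t' b y =>
      block_equiv_rec n' (block_cat s' (a :: x)) (block_cat t' (b :: y))
      && block_equiv_rec n' (block_cat s' x) (block_cat t' y)
  | _, _, _ => false
  end.

Definition block_equiv s t : bool := block_equiv_rec (dim s) s t.

Lemma block_equiv_word u v : block_equiv (Word u) (Word v) = (u == v).
Proof. by []. Qed.

Lemma block_equiv_ins s a x t b y :
  block_equiv (Ins s a x) (Ins t b y) =
  block_equiv (block_cat s (a :: x)) (block_cat t (b :: y))
  && block_equiv (block_cat s x) (block_cat t y).
Proof. by rewrite /block_equiv /= !dim_cat. Qed.

(* sigma(I+, I-), with I+ and I- given as predicates on the 1-based positions
   1, ..., dim s (values elsewhere are irrelevant); [P] takes precedence over
   [N] where they overlap, so only disjoint arguments are meaningful. *)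
Fixpoint sub_block (P N : pred nat) s : block :=
  match s with
  | Word u => Word u
  | Ins s' a x =>
      let t := sub_block P N s' in
      if P (dim s').+1 then block_cat t (a :: x)
      else if N (dim s').+1 then block_cat t x
      else Ins t a x
  end.

(* v_I(sigma). *)
Fixpoint vertex (P : pred nat) s : seq Sigma :=
  match s with
  | Word u => u
  | Ins s' a x => vertex P s' ++ (if P (dim s').+1 then a :: x else x)
  end.

Lemma vertexE P s : sub_block P (predC P) s = Word (vertex P s).
Proof. by elim: s => //= s -> a x; case: (P _). Qed.

Lemma vertex_cat P s w : vertex P (block_cat s w) = vertex P s ++ w.
Proof. by case: s => //= s a x; case: ifP; rewrite -catA. Qed.

Lemma dim0P s : dim s = 0 -> exists u, s = Word u.
Proof. by case: s => // u _; exists u. Qed.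

Lemma eq_vertex P Q s : (forall i, 0 < i <= dim s -> P i = Q i)%N ->
  vertex P s = vertex Q s.
Proof.
elim: s => //= s IH a x h; rewrite (h (dim s).+1) ?leqnn //.
rewrite (IH _) // => i /andP[i0 li]; apply: h; rewrite i0 /=.
exact: leq_trans li _.
Qed.

Lemma block_equivP s t :
  reflect (dim s = dim t /\ forall P, vertex P s = vertex P t)
          (block_equiv s t).
Proof.
move en: (dim s) => n; elim: n s t en => [|n IH] [u|s a x] [v|t b y] //= en.
- apply: (iffP idP); first by rewrite block_equiv_word => /eqP ->.
  by case=> _ /(_ xpredT) ->; rewrite block_equiv_word.
- by apply: (iffP idP) => [//|[]].
- by apply: (iffP idP) => [//|[]].
case: en => en; rewrite block_equiv_ins.
apply: (iffP andP).
- case=> /IH [|d h]; first by rewrite dim_cat.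
  move=> /IH [|d' h']; first by rewrite dim_cat.
  rewrite dim_cat in d; split; first by rewrite -d.
  move=> P; move: (h P) (h' P); rewrite !vertex_cat en -d.
  by case: (P n.+1).
case=> [[d] h]; split; apply/IH; rewrite ?dim_cat //; split=> // P.
- rewrite !vertex_cat.
  have /= := h (fun i => (i <= n)%N && P i || (i == n.+1)).
  rewrite en -d eqxx orbT.
  by rewrite !(@eq_vertex _ P) // => i /andP[_]; rewrite -?d ?en => li;
     rewrite li /= (ltn_eqF (_ : i < n.+1)%N) ?orbF.
- rewrite !vertex_cat.
  have /= := h (fun i => (i <= n)%N && P i).
  rewrite en -d ltnn /=.
  by rewrite !(@eq_vertex _ P) // => i /andP[_]; rewrite -?d ?en => ->.
Qed.

Lemma block_equiv_refl : reflexive block_equiv.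
Proof. by move=> s; apply/block_equivP. Qed.

Lemma block_equiv_sym : symmetric block_equiv.
Proof.
by move=> s t; apply/block_equivP/block_equivP => -[-> h]; split=> // P;
  rewrite h.
Qed.

Lemma block_equiv_trans : transitive block_equiv.
Proof.
move=> s t r /block_equivP[d h] /block_equivP[d' h'].
by apply/block_equivP; split=> [|P]; rewrite (d, h).
Qed.

Canonical block_equiv_equiv :=
  EquivRel block_equiv block_equiv_refl block_equiv_sym block_equiv_trans.

Fixpoint canonical s : bool :=
  match s with
  | Word _ => true
  | Ins s' a x => canonical s' && (ohead x != Some a)
  end.

(* The canonical form of s w: the leading letters a of the word that follows
   (1,a) are moved to the left of (1,a). *)
Fixpoint canon_cat s w : block :=
  match s with
  | Word u => Word (u ++ w)
  | Ins s' a x =>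
      let n := find (predC1 a) (x ++ w) in
      Ins (canon_cat s' (nseq n a)) a (drop n (x ++ w))
  end.

Definition canon s : block := canon_cat s [::].

Lemma dim_canon_cat s w : dim (canon_cat s w) = dim s.
Proof. by elim: s w => //= s IH a x w; rewrite IH. Qed.

Lemma find_nseq a w :
  w = nseq (find (predC1 a) w) a ++ drop (find (predC1 a) w) w.
Proof.
elim: w => //= c w IH; rewrite /predC1 /=.
by case: eqP => //= ->; rewrite -IH.
Qed.

Lemma vertex_canon_cat P s w : vertex P (canon_cat s w) = vertex P s ++ w.
Proof.
elim: s w => //= s IH a x w; rewrite IH dim_canon_cat -!catA.
have := find_nseq a (x ++ w).
move: (find _ _) (drop _ _) => n y e; congr (_ ++ _).
by case: ifP => _ /=; rewrite e //; elim: n {e} => //= n ->.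
Qed.

Lemma canon_equiv s : block_equiv (canon s) s.
Proof.
by apply/block_equivP; split=> [|P];
  rewrite ?dim_canon_cat // vertex_canon_cat cats0.
Qed.

Lemma canonical_canon_cat s w : canonical (canon_cat s w).
Proof.
elim: s w => //= s IH a x w; rewrite IH /=.
elim: (x ++ w) => //= c {}w; rewrite /predC1 /=.
by case: (eqVneq c a) => //= ne _; apply: contraNneq ne => -[->].
Qed.

Lemma canonical_canon s : canonical (canon s).
Proof. exact: canonical_canon_cat. Qed.

Lemma canonical_word_uniq u a x v b y :
  u ++ a :: x = v ++ b :: y -> u ++ x = v ++ y ->
  ohead x != Some a -> ohead y != Some b -> [/\ u = v, a = b & x = y].
Proof.
elim: u v => [|c u IH] [|d v] /=.
- by case=> -> ->.
- case=> <- e1 e2; rewrite e2 /=.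
  by case/eqP.
- by case=> <- e1 e2 _; rewrite -e2 /=; case/eqP.
by case=> <- e1 [e2] h1 h2; have [-> -> ->] := IH _ e1 e2 h1 h2.
Qed.

Lemma canonical_uniq s t :
  canonical s -> canonical t -> block_equiv s t -> s = t.
Proof.
elim: s t => [u|s IH a x] [v|t b y] //= cs ct.
  by rewrite block_equiv_word => /eqP ->.
case/andP: cs ct => cs hx /andP[ct hy] /block_equivP[/= [d] h].
have key P : [/\ vertex P s = vertex P t, a = b & x = y].
  have /= := h (fun i => (i <= dim s)%N && P i || (i == (dim s).+1)).
  have /= := h (fun i => (i <= dim s)%N && P i).
  rewrite -d !eqxx !ltnn !orbT /=.
  rewrite !(@eq_vertex (fun i => (i <= dim s)%N && P i) P); first last.
  - by move=> i /andP[_]; rewrite ?d => ->.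
  - by move=> i /andP[_]; rewrite ?d => ->.
  rewrite !(@eq_vertex (fun i => (i <= dim s)%N && P i || _) P); first last.
  - by move=> i /andP[_] li; rewrite li /= ltn_eqF ?orbF.
  - by move=> i /andP[_]; rewrite -d => li; rewrite li /= ltn_eqF ?orbF.
  by move=> e1 e2; apply: canonical_word_uniq.
have [_ -> ->] := key xpredT; congr (Ins _ _ _).
by apply: IH => //; apply/block_equivP; split=> // P; have [] := key P.
Qed.

Lemma canon_id s : canonical s -> canon s = s.
Proof.
by move=> cs; apply: canonical_uniq (canon_equiv s) => //;
  apply: canonical_canon.
Qed.

Lemma canon_eqP s t : reflect (canon s = canon t) (block_equiv s t).
Proof.
apply: (iffP idP) => [e|e]; last first.
  apply: block_equiv_trans (canon_equiv t).
  by rewrite -e block_equiv_sym canon_equiv.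
apply: canonical_uniq; rewrite ?canonical_canon //.
apply: block_equiv_trans (canon_equiv s) _.
by apply: block_equiv_trans e _; rewrite block_equiv_sym canon_equiv.
Qed.

(* For a block in canonical form: no two consecutive (1,a)(1,a) separated by
   the empty word. *)
Fixpoint separated s : bool :=
  match s with
  | Word _ => true
  | Ins t b _ => separated t && (if t is Ins _ a [::] then a != b else true)
  end.

Definition block_class := {eq_quot block_equiv}.

HB.instance Definition _ : EqQuotient block block_equiv block_class :=
  EqQuotient.on block_class.
HB.instance Definition _ := Choice.on block_class.

Implicit Types q : block_class.

Lemma block_class_eqP s t :
  reflect (\pi_block_class s = \pi t) (block_equiv s t).
Proof. by apply: (iffP idP) => [/eqmodP|/eqmodP]. Qed.

Lemma repr_equiv s : block_equiv (repr (\pi_block_class s)) s.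
Proof. by apply/block_class_eqP; rewrite reprK. Qed.

(* The operations of a class are computed on the representative [repr q]; the
   lemmas [*_pi] below state that they do not depend on it. *)
Definition class_dim q : nat := dim (repr q).

(* V(sigma). *)
Definition vertices q : set (seq Sigma) :=
  range (fun P => vertex P (repr q)).

Definition valid q : bool := separated (canon (repr q)).

Definition upper_face (i : nat) q : block_class :=
  \pi_block_class (sub_block (pred1 i) pred0 (repr q)).

Definition lower_face (i : nat) q : block_class :=
  \pi_block_class (sub_block pred0 (pred1 i) (repr q)).

Lemma class_dim_pi s : class_dim (\pi_block_class s) = dim s.
Proof. by have /block_equivP[] := repr_equiv s. Qed.

Lemma vertices_pi s :
  vertices (\pi_block_class s) = range (fun P => vertex P s).
Proof.
have /block_equivP[_ h] := repr_equiv s.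
by apply/seteqP; split=> _ [P _ <-]; exists P; rewrite ?h.
Qed.

Lemma valid_pi s : valid (\pi_block_class s) = separated (canon s).
Proof. by rewrite /valid (elimT (canon_eqP _ _) (repr_equiv s)). Qed.

(* The number of positions at most n that remain in sigma(I+, I-). *)
Definition free_pos (P N : pred nat) n := count (fun i => ~~ (P i || N i)) (iota 1 n).

Lemma free_posS P N n : free_pos P N n.+1 = (free_pos P N n + ~~ (P n.+1 || N n.+1))%N.
Proof. by rewrite /free_pos -[in LHS](addn1 n) iotaD count_cat /= addn0 add1n. Qed.

Lemma dim_sub_block P N s : dim (sub_block P N s) = free_pos P N (dim s).
Proof.
elim: s => //= s IH a x; rewrite free_posS -IH.
by case: (P _) => /=; rewrite ?dim_cat ?addn0 //; case: (N _) => /=;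
  rewrite ?dim_cat ?addn0 ?addn1.
Qed.

Lemma vertex_sub_block P N Q s :
  vertex Q (sub_block P N s) =
  vertex (fun i => P i || ~~ N i && Q (free_pos P N i)) s.
Proof.
elim: s => //= s IH a x.
case Pi: (P _) => /=; rewrite ?vertex_cat ?IH //.
case Ni: (N _) => /=; rewrite ?vertex_cat ?IH //.
by rewrite dim_sub_block free_posS Pi Ni addn1.
Qed.

Lemma sub_block_equiv P N s t :
  block_equiv s t -> block_equiv (sub_block P N s) (sub_block P N t).
Proof.
move=> /block_equivP[d h]; apply/block_equivP.
by split=> [|Q]; rewrite ?dim_sub_block ?d ?vertex_sub_block ?h.
Qed.

Lemma upper_face_pi i s :
  upper_face i (\pi_block_class s) = \pi_block_class (sub_block (pred1 i) pred0 s).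
Proof. exact/block_class_eqP/sub_block_equiv/repr_equiv. Qed.

Lemma lower_face_pi i s :
  lower_face i (\pi_block_class s) = \pi_block_class (sub_block pred0 (pred1 i) s).
Proof. exact/block_class_eqP/sub_block_equiv/repr_equiv. Qed.

Lemma dim_upper_face i q :
  (0 < i <= class_dim q)%N -> class_dim (upper_face i q) = (class_dim q).-1.
Proof.
rewrite class_dim_pi dim_sub_block /class_dim.
elim: (dim _) => [|n IH] /andP[i0]; first by rewrite leqn0 (gtn_eqF i0).
rewrite free_posS /= orbF leq_eqVlt => /orP[/eqP ei|li].
  rewrite ei eqxx addn0 /free_pos.
  apply: (etrans _ (size_iota 1 n)); rewrite -count_predT.
  apply: eq_in_count => j; rewrite mem_iota add1n => /andP[_ lj] /=.
  by rewrite orbF ltn_eqF.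
rewrite gtn_eqF // IH ?i0 // addn1 prednK //.
exact: leq_trans i0 li.
Qed.

Lemma dim_lower_face i q :
  (0 < i <= class_dim q)%N -> class_dim (lower_face i q) = (class_dim q).-1.
Proof.
move=> h; rewrite -(dim_upper_face h) !class_dim_pi !dim_sub_block.
by apply: eq_count => j; rewrite orbC.
Qed.

Lemma vertices_upper_face i q : (vertices (upper_face i q) `<=` vertices q)%classic.
Proof.
rewrite vertices_pi => _ [Q _ <-]; rewrite vertex_sub_block.
by eexists.
Qed.

Lemma vertices_lower_face i q : (vertices (lower_face i q) `<=` vertices q)%classic.
Proof.
rewrite vertices_pi => _ [Q _ <-]; rewrite vertex_sub_block.
by eexists.
Qed.

Lemma sub_block_upper_id i s :
  (dim s < i)%N -> sub_block (pred1 i) pred0 s = s.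
Proof.
by elim: s => //= s IH a x h; rewrite IH 1?ltnW // ltn_eqF.
Qed.

Lemma canonical_upper i s : canonical s -> separated s ->
  canonical (sub_block (pred1 i) pred0 s)
  && separated (sub_block (pred1 i) pred0 s).
Proof.
elim: s => //= s IH a x /andP[cs hx] /andP[ss hs].
case: eqP => [<-|_].
  rewrite sub_block_upper_id //.
  case: s {IH} cs ss hs => //= t b [|c y] /= /andP[-> hb] /andP[-> ->];
    rewrite !andbT => // ba.
  by apply: contraNneq ba => -[->].
have /andP[/= -> ->] := IH cs ss; rewrite hx /=.
case: s hs {IH cs ss} => //= t b y hy.
by case: ifP => // _; case: (sub_block _ _ t) => // ? ? [].
Qed.

Lemma valid_upper_face i q : valid q -> valid (upper_face i q).
Proof.
rewrite /valid => h.
have /andP[cs ss] := canonical_upper i (canonical_canon (repr q)) h.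
have e : block_equiv (sub_block (pred1 i) pred0 (repr q))
                     (sub_block (pred1 i) pred0 (canon (repr q))).
  by apply: sub_block_equiv; rewrite block_equiv_sym canon_equiv.
by rewrite -/(valid _) valid_pi (elimT (canon_eqP _ _) e) canon_id.
Qed.

(* The k-dimensional elements of C^B[W]. *)
Definition in_complex (W : set (seq Sigma)) (k : nat) q : bool :=
  [&& valid q, class_dim q == k & `[< (vertices q `<=` W)%classic >]].

Lemma upper_face_in_complex W k i q : (0 < i <= k)%N ->
  in_complex W k q -> in_complex W k.-1 (upper_face i q).
Proof.
move=> ik /and3P[vq /eqP dq /asboolP VW].
rewrite /in_complex valid_upper_face // dim_upper_face dq ?eqxx //=.
by apply/asboolP; apply: subset_trans VW; apply: vertices_upper_face.
Qed.

Lemma lower_face_in_complex W k i q : (0 < i <= k)%N ->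
  in_complex W k q -> in_complex W k.-1 (lower_face i q) = valid (lower_face i q).
Proof.
move=> ik /and3P[vq /eqP dq /asboolP VW].
rewrite /in_complex dim_lower_face dq ?eqxx //=; case: valid => //=.
by apply/asboolP; apply: subset_trans VW; apply: vertices_lower_face.
Qed.

End Blocks.

Section ChainComplex.
Variables (Sigma : finType) (W : set (seq Sigma)).

Definition cell (k : nat) := {q : block_class Sigma | in_complex W k q}.

Definition chain (k : nat) := {freeg (cell k)}.

(* The generator of the chain group given by q, or 0 if q is not in C^B[W].
   By [upper_face_in_complex] and [lower_face_in_complex], on the faces of a
   k-cell the second case occurs exactly for the invalid lower faces. *)
Definition cell_chain (k : nat) (q : block_class Sigma) : chain k :=
  if insub q is Some c then << c >> else 0.

Definition boundary_cell (k : nat) (c : cell k) : chain k.-1 :=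
  \sum_(1 <= i < k.+1)
    (-1) ^+ i.+1 *: (cell_chain k.-1 (upper_face i (val c))
                     - cell_chain k.-1 (lower_face i (val c))).

(* For k = 0 the sum defining [boundary_cell] is empty: this is the zero map. *)
Definition boundary (k : nat) : chain k -> chain k.-1 :=
  fglift (@boundary_cell k).

HB.instance Definition _ k :=
  GRing.isZmodMorphism.Build (chain k) (chain k.-1) (@boundary k)
    (lift_is_additive _).

Definition is_cycle k : {pred chain k} := fun z => boundary z == 0.

Lemma is_cycle_zmod_closed k : zmod_closed (@is_cycle k).
Proof.
split=> [|x y]; rewrite !unfold_in /is_cycle ?raddf0 //.
by move=> /eqP hx /eqP hy; rewrite raddfB /= hx hy subr0.
Qed.

HB.instance Definition _ k :=
  GRing.isZmodClosed.Build (chain k) (@is_cycle k) (@is_cycle_zmod_closed k).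

Record cycles (k : nat) := Cycle {
  cycle_chain :> chain k;
  _ : cycle_chain \in @is_cycle k
}.

HB.instance Definition _ k := [isSub for @cycle_chain k].
HB.instance Definition _ k := [Choice of cycles k by <:].
HB.instance Definition _ k := [SubChoice_isSubZmodule of cycles k by <:].

(* As the image of [boundary k.+1] is taken inside the cycles, the quotient
   below is ker / im without a separate proof that im is contained in ker. *)
Definition is_boundary (k : nat) : {pred cycles k} :=
  fun z => `[< exists c : chain k.+1, boundary c = z >].

Lemma is_boundary_zmod_closed k : zmod_closed (@is_boundary k).
Proof.
split=> [|x y]; first by apply/asboolP; exists 0; rewrite raddf0.
move=> /asboolP[c hc] /asboolP[d hd]; apply/asboolP; exists (c - d).
by rewrite !raddfB /= hc hd.
Qed.

HB.instance Definition _ k :=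
  GRing.isZmodClosed.Build (cycles k) (@is_boundary k)
    (@is_boundary_zmod_closed k).

Definition homology (k : nat) : zmodType := Quotient.quot (@is_boundary k).

End ChainComplex.

Definition finitely_generated (A : zmodType) : Prop :=
  exists s : seq A, forall x : A,
    exists c : 'I_(size s) -> int, x = \sum_(i < size s) s`_i *~ c i.

Definition isomorphic (A B : zmodType) : Prop :=
  exists f : {additive A -> B}, bijective f.

(* Main.v *)
From HB Require Import structures.
Require Import Defs.
From mathcomp Require Import all_boot all_order all_algebra.
From mathcomp Require Import boolp classical_sets cardinality functions.
From mathcomp Require Import freeg zify.

(** A word [l_1 b l_2 b ... l_N b] with every [l_i] equal to [1] or [a] records a
subset of an [N]-element set, that is, a vertex of the cube [{0,1}^N].  A block
all of whose vertices are such words is a subcube: all its vertices contain the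
same number of letters [b], so only letters [a] are inserted, and since every
[a] is followed by a [b], each of them goes to a slot [l_i] of its own
([blk_surj]).  These blocks are valid, and so are their faces.  So for a set [W]
of such words the insertion chain complex is the cellular chain complex of the
full cubical complex spanned by [W] ([in_complex_blk], [code_chain_bd]).

Let [W] consist of the nonempty faces of a simplicial complex [K] on the [N]
coordinates.  Adding the empty face makes the cubical complex contractible, by
turning coordinates [1] into [0] one after the other; this is an explicit
homotopy [cube_htpy].  The added cubes are the intervals from the empty face to
a simplex of [K], so the quotient by the complex of [W] is the augmented
simplicial chain complex of [K] shifted by one degree, and [H_k(W)] is the
reduced [H_k(K)].  On chains: a cycle [z] bounds [cube_htpy z], whose part on
the added cubes is a simplicial cycle of [K] ([theta_bd], [theta_inj],
[theta_surj]).

Given an [A]-valued cochain [L] on [k]-simplices, let [K] contain every set of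
at most [k+1] vertices, and those sets of [k+2] vertices on which the coboundary
of [L] vanishes.  Then pairing with [L] maps [H_k(K)] to [A].  If [L] vanishes on
all simplices through one vertex, the [k]-cycles of [K] are freely determined by
their part away from this vertex, and the map is bijective as soon as the values
of [L] generate [A] and all relations between the values of [L] follow from two
evident kinds: a simplex with value [0] is trivial, and the boundary of a simplex
with zero coboundary is trivial ([presents], [presents_cone]).

It remains to find such a cochain.  Adding a vertex to all simplices raises [k]
by one ([presents_suspension]), which leaves [k = 1], where [L] labels the edges
of a complete graph.  As subgroups of [Z^n] are finitely generated, [A] has a
finite family of generators all of whose relations follow from relations
[x + y = z] between members ([additive_presentation]).  The vertices of the graph
are chosen so that each such relation is a triangle, and so that triangles with
one side labelled [0] identify all edges with the same label
([graph_presents]). *)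

Set Implicit Arguments.
Unset Strict Implicit.
Unset Printing Implicit Defensive.

Import GRing.Theory.

(** * Integer-valued functions and their supports *)

Section FunctionModule.
Local Open Scope ring_scope.
Variables (T : Type) (V : zmodType).
Implicit Types f g : T -> V.

Lemma fun_addE f g x : (f + g) x = f x + g x. Proof. by []. Qed.
Lemma fun_oppE f x : (- f) x = - f x. Proof. by []. Qed.
Lemma fun_zeroE x : (0 : T -> V) x = 0. Proof. by []. Qed.
Lemma fun_mulzE f m x : (f *~ m) x = f x *~ m.
Proof. by case: m => m; rewrite /intmul ?fun_oppE natmulfctE. Qed.
Definition funE := (fun_addE, fun_oppE, fun_zeroE).
End FunctionModule.

Section FunctionSupport.
Local Open Scope ring_scope.
Variable T : Type.

Definition supp (P : pred T) (f : T -> int) : Prop :=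
  forall x, f x != 0 -> P x.

Lemma suppB (P : pred T) (f1 f2 : T -> int) : supp P f1 -> supp P f2 -> supp P (f1 - f2).
Proof.
move=> h1 h2 e; rewrite ?funE => h.
have [h0|] := eqVneq (f1 e) 0; last exact: h1.
by apply: h2; apply: contraNneq h => ->; rewrite h0 subr0.
Qed.

Lemma suppP0 (P : pred T) (f : T -> int) (e : T) : supp P f -> ~~ P e -> f e = 0.
Proof. by move=> h; apply: contraNeq => /h. Qed.

Lemma supp_sub (P Q : pred T) (f : T -> int) :
  (forall x, P x -> Q x) -> supp P f -> supp Q f.
Proof. by move=> PQ h e /h /PQ. Qed.

End FunctionSupport.

(** * The cellular chain complex of a cube *)

Section Cubes.
Local Open Scope ring_scope.

Implicit Types (e : seq (option bool)) (f g : seq (option bool) -> int).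

(** A face of the cube is coded by the list of its coordinates, with [None] for a
free coordinate.  The head of the list is the last coordinate, as blocks are
nested to the left.  Chains are functions on codes: the boundary at a given code
only involves its finitely many cofaces, so no finiteness condition is needed. *)
Definition stars e : nat := count (pred1 None) e.

Definition along T (x : T) (f : seq T -> int) : seq T -> int :=
  fun c => f (x :: c).

Definition star_sign e : int := (-1) ^+ stars e.

(** The sign of the two faces in a free head coordinate is determined by the
number of free coordinates before it, which are those of the tail. *)
Fixpoint cube_bd f e : int :=
  if e is x :: e' then
    cube_bd (along x f) e' +
    match x with
    | Some true => star_sign e' * f (None :: e')
    | Some false => - (star_sign e' * f (None :: e'))
    | None => 0
    end
  else 0.

(** The homotopy that contracts the cube to the origin: moving the head
coordinate from [1] to [0] sweeps out the free coordinate, and afterwards both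
halves of the chain lie in the face [0], where the other coordinates are
contracted. *)
Fixpoint cube_htpy f e : int :=
  match e with
  | [::] => 0
  | Some false :: e' =>
      cube_htpy (along (Some false) f + along (Some true) f) e'
  | Some true :: _ => 0
  | None :: e' => star_sign e' * f (Some true :: e')
  end.

Lemma alongB T (x : T) (f g : seq T -> int) :
  along x (f - g) = along x f - along x g.
Proof. by []. Qed.

Lemma cube_bdB f g : cube_bd (f - g) = cube_bd f - cube_bd g.
Proof.
apply/funext => e; elim: e f g => [|x e IH] f g /=; first by rewrite ?funE subr0.
rewrite alongB IH ?funE /= ?funE.
by case: x => [[]|]; lia.
Qed.

Lemma cube_bd0 : cube_bd 0 = 0.
Proof. by rewrite -[X in cube_bd X](subrr 0) cube_bdB subrr. Qed.

Lemma cube_bdN f : cube_bd (- f) = - cube_bd f.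
Proof. by rewrite -sub0r cube_bdB cube_bd0 sub0r. Qed.

Lemma cube_bdD f g : cube_bd (f + g) = cube_bd f + cube_bd g.
Proof. by rewrite -[g in LHS]opprK cube_bdB cube_bdN opprK. Qed.

Lemma cube_htpyB f g : cube_htpy (f - g) = cube_htpy f - cube_htpy g.
Proof.
apply/funext => e; elim: e f g => [|[[]|] e IH] f g /=;
  rewrite ?funE ?subr0 //= ?funE.
  by rewrite !alongB addrACA -opprD IH.
by lia.
Qed.

Definition signed f : seq (option bool) -> int := fun e => star_sign e * f e.

Lemma star_signS e : star_sign (None :: e) = - star_sign e.
Proof. by rewrite /star_sign /= exprS mulN1r. Qed.

Lemma star_sign_Some y e : star_sign (Some y :: e) = star_sign e.
Proof. by []. Qed.

Lemma star_sign_sqr e : star_sign e * star_sign e = 1.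
Proof. by rewrite -expr2 sqrr_sign. Qed.

(** The boundary lowers the degree by one. *)
Lemma cube_bd_signed f : cube_bd (signed f) = - signed (cube_bd f).
Proof.
apply/funext => e; elim: e f => [|x e IH] f /=.
  by rewrite ?funE /signed /= mulr0 oppr0.
rewrite ?funE /signed /=.
case: x => [y|].
  rewrite (_ : along _ _ = signed (along (Some y) f)); last by [].
  rewrite IH ?funE /signed star_signS star_sign_Some.
  by case: y => /=; lia.
rewrite (_ : along _ _ = - signed (along None f)); last first.
  by apply/funext=> c; rewrite /along /= ?funE /signed star_signS mulNr.
by rewrite cube_bdN ?funE IH ?funE /signed star_signS; lia.
Qed.

Lemma cube_bdK f : cube_bd (cube_bd f) = 0.
Proof.
apply/funext => e; elim: e f => [|x e IH] f //=.
pose F x := along x f.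
have b1 : along (Some true) (cube_bd f) = cube_bd (F (Some true)) + signed (F None) by [].
have b0 : along (Some false) (cube_bd f) = cube_bd (F (Some false)) - signed (F None) by [].
have bs : along None (cube_bd f) = cube_bd (F None).
  by apply/funext=> c; rewrite /along /= addr0.
case: x => [[]|].
- rewrite b1 cube_bdD cube_bd_signed ?funE IH /signed.
  by rewrite /= -/(F None) addr0; lia.
- rewrite b0 cube_bdB cube_bd_signed ?funE IH /signed.
  by rewrite /= -/(F None) addr0; lia.
by rewrite bs IH addr0.
Qed.

(** The end of the contraction: the chain pushed to the origin, where only its
component in degree [0] survives. *)
Fixpoint push_origin f e : int :=
  match e with
  | [::] => f [::]
  | Some false :: e' => push_origin (along (Some false) f + along (Some true) f) e'
  | _ => 0
  end.

Lemma cube_htpyE f :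
  cube_bd (cube_htpy f) + cube_htpy (cube_bd f) = f - push_origin f.
Proof.
apply/funext => e; elim: e f => [|x e IH] f; rewrite ?funE /=.
  by rewrite subrr addr0.
pose F x := along x f.
have b1 : along (Some true) (cube_bd f) = cube_bd (F (Some true)) + signed (F None) by [].
have b0 : along (Some false) (cube_bd f) = cube_bd (F (Some false)) - signed (F None) by [].
have b10 : along (Some false) (cube_bd f) + along (Some true) (cube_bd f)
    = cube_bd (F (Some false) + F (Some true)).
  rewrite b0 b1 cube_bdD addrACA; by rewrite addNr addr0.
have h0 : along (Some false) (cube_htpy f) = cube_htpy (F (Some false) + F (Some true)) by [].
have h1 : along (Some true) (cube_htpy f) = 0 by [].
have hs : along None (cube_htpy f) = signed (F (Some true)) by [].
case: x => [[]|] /=.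
- by rewrite h1 cube_bd0 mulrA star_sign_sqr mul1r; lia.
- rewrite b10 h0.
  have := IH (F (Some false) + F (Some true)); rewrite ?funE => h.
  rewrite mulrA star_sign_sqr mul1r -/(F (Some false)) -/(F (Some true)).
  rewrite addrAC h /F /along. 
  rewrite ?funE /=; lia.
rewrite hs cube_bd_signed ?funE /signed /= addr0 -/(F (Some true)).
rewrite mulrDr mulrA star_sign_sqr mul1r /F.
by rewrite subr0 addKr.
Qed.

End Cubes.

(** * Simplices, cochains and the support of chains *)

Section Words.
Local Open Scope ring_scope.
Variable T : finType.

Fixpoint codes (n : nat) : seq (seq T) :=
  if n is m.+1 then [seq x :: e | x <- enum T, e <- codes m] else [:: [::]].

Lemma mem_codes n e : (e \in codes n) = (size e == n).
Proof.
elim: n e => [|n IH] e /=; first by rewrite inE size_eq0.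
apply/allpairsP/idP => [[[x c] /= [_ h ->]]|].
  by rewrite /= eqSS -IH.
case: e => //= x e; rewrite eqSS -IH => h.
by exists (x, e); rewrite /= mem_enum.
Qed.

Lemma uniq_codes n : uniq (codes n).
Proof.
elim: n => //= n IH; apply: allpairs_uniq => //; first exact: enum_uniq.
by move=> [x c] [y d] _ _ [-> ->].
Qed.

Lemma big_codesS (V : zmodType) n (F : seq T -> V) :
  \sum_(e <- codes n.+1) F e = \sum_(x : T) \sum_(e <- codes n) F (x :: e).
Proof. by rewrite /= big_allpairs_dep /= big_enum. Qed.

Lemma sum_codes_delta n (f : seq T -> int) c :
  \sum_(e <- codes n) (c == e)%:R * f e = (if size c == n then f c else 0).
Proof.
case: ifP => hc; last first.
  rewrite big_seq big1 // => e; rewrite mem_codes => he.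
  by case: eqP => [ce|_]; [rewrite ce he in hc | rewrite mul0r].
rewrite (bigD1_seq c) ?uniq_codes ?mem_codes //= eqxx mul1r.
rewrite big1_seq ?addr0 // => e /andP[ne _].
by rewrite eq_sym (negbTE ne) mul0r.
Qed.

End Words.

Section Simplices.
Local Open Scope ring_scope.
Implicit Types (v u : seq bool) (g h : seq bool -> int) (f : seq (option bool) -> int).

(** The simplex with vertex set [v] is the cube from the empty set to [v]. *)
Definition simplex_code : seq bool -> seq (option bool) :=
  map (fun x => if x then None else Some false).

Definition top : seq (option bool) -> seq bool :=
  map (fun x => x != Some false).

Definition simp f : seq bool -> int := f \o simplex_code.

(** A simplicial chain as a chain of cubes through the empty set. *)
Definition emb g : seq (option bool) -> int :=
  fun e => if Some true \in e then 0 else g (top e).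

Definition card_sign v : int := (-1) ^+ count id v.

Fixpoint simp_bd g v : int :=
  if v is x :: v' then
    simp_bd (along x g) v' - (if x then 0 else card_sign v' * g (true :: v'))
  else 0.

Lemma stars_simplex_code v : stars (simplex_code v) = count id v.
Proof. by elim: v => //= -[] v <-. Qed.

Lemma size_simplex_code v : size (simplex_code v) = size v.
Proof. exact: size_map. Qed.

Lemma top_simplex_code v : top (simplex_code v) = v.
Proof. by elim: v => //= -[] v ->. Qed.

Lemma simplex_code_no_one v : Some true \notin simplex_code v.
Proof. by elim: v => //= -[] v h; rewrite inE. Qed.

Lemma simplex_code_top e : Some true \notin e -> simplex_code (top e) = e.
Proof. by elim: e => //= -[[]|] e IH; rewrite inE //= => /IH ->. Qed.

(** A cube through the empty set has upper faces away from the empty set and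
lower faces through it, so modulo cubes away from the empty set its boundary is
the simplicial one, up to sign. *)
Lemma simp_cube_bd f : simp (cube_bd f) = simp_bd (simp f).
Proof.
apply/funext => v; rewrite /simp /=; elim: v f => //= -[] v IH f /=.
  by rewrite addr0 subr0 IH.
by rewrite /star_sign stars_simplex_code IH.
Qed.

Lemma simp_emb g : simp (emb g) = g.
Proof.
apply/funext => v.
by rewrite /simp /emb /= (negbTE (simplex_code_no_one v)) top_simplex_code.
Qed.

Lemma simpB f1 f2 : simp (f1 - f2) = simp f1 - simp f2. Proof. by []. Qed.
Lemma simpN f1 : simp (- f1) = - simp f1. Proof. by []. Qed.

Lemma simp_bdE g : simp_bd g = simp (cube_bd (emb g)).
Proof. by rewrite simp_cube_bd simp_emb. Qed.

Lemma embB g h : emb (g - h) = emb g - emb h.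
Proof.
by apply/funext => e; rewrite ?funE /emb ?funE; case: ifP => _ //; rewrite subr0.
Qed.

Lemma simp_bdB g h : simp_bd (g - h) = simp_bd g - simp_bd h.
Proof. by rewrite !simp_bdE embB cube_bdB simpB. Qed.

Lemma simp_bd0 : simp_bd 0 = 0.
Proof. by rewrite -[X in simp_bd X](subrr 0) simp_bdB subrr. Qed.

Lemma simp_bdN g : simp_bd (- g) = - simp_bd g.
Proof. by rewrite -sub0r simp_bdB simp_bd0 sub0r. Qed.

Lemma simp_bdD g h : simp_bd (g + h) = simp_bd g + simp_bd h.
Proof. by rewrite -[h in LHS]opprK simp_bdB simp_bdN opprK. Qed.

Lemma simp_bdK g : simp_bd (simp_bd g) = 0.
Proof. by rewrite [simp_bd g]simp_bdE -simp_cube_bd cube_bdK. Qed.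

Definition card_signed g : seq bool -> int := fun v => card_sign v * g v.

Lemma card_signedK : involutive card_signed.
Proof.
by move=> g; apply/funext => v; rewrite /card_signed mulrA -expr2 sqrr_sign mul1r.
Qed.

Lemma card_signedN g : card_signed (- g) = - card_signed g.
Proof. by apply/funext => v; rewrite /card_signed ?funE mulrN. Qed.

Lemma simp_signed f : simp (signed f) = card_signed (simp f).
Proof.
by apply/funext=> v; rewrite /simp /signed /card_signed /= /star_sign stars_simplex_code.
Qed.

Lemma simp_bd_signed g : simp_bd (card_signed g) = - card_signed (simp_bd g).
Proof.
rewrite -{1}[g]simp_emb -simp_signed -simp_cube_bd cube_bd_signed simpN.
by rewrite simp_signed -simp_bdE.
Qed.

Lemma along_true_bd g : along true (simp_bd g) = simp_bd (along true g).
Proof. by apply/funext => v; rewrite {1}/along /= subr0. Qed.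

Lemma along_false_bd g :
  along false (simp_bd g) = simp_bd (along false g) - card_signed (along true g).
Proof. by []. Qed.

Lemma along_eq g h : along false g = along false h -> along true g = along true h ->
  g [::] = h [::] -> g = h.
Proof.
by move=> h0 h1 hn; apply/funext => -[|[] v] //;
  [move/(congr1 (fun F => F v)): h1 | move/(congr1 (fun F => F v)): h0].
Qed.

Section Pairing.
Variable A : zmodType.
Implicit Type L : seq bool -> A.

(** The coboundary of a cochain, adjoint to [simp_bd] (see [pairing_cobd]). *)
Fixpoint cobd L v : A :=
  if v is x :: v' then
    cobd (fun u => L (x :: u)) v'
    - (if x then L (false :: v') *~ card_sign v' else 0)
  else 0.

Definition pairing n L g : A := \sum_(v <- codes bool n) L v *~ g v.

Lemma pairingS n L g :
  pairing n.+1 L g = pairing n (fun u => L (true :: u)) (along true g)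
                   + pairing n (fun u => L (false :: u)) (along false g).
Proof. by rewrite /pairing big_codesS big_bool. Qed.

Lemma pairingB n L g h : pairing n L (g - h) = pairing n L g - pairing n L h.
Proof. by rewrite /pairing -sumrB; apply: eq_bigr => v _; rewrite ?funE mulrzBr. Qed.

Lemma pairing0 n L : pairing n L 0 = 0.
Proof. by rewrite -[X in pairing _ _ X](subrr 0) pairingB subrr. Qed.

Lemma pairingN n L g : pairing n L (- g) = - pairing n L g.
Proof. by rewrite -[- g]sub0r pairingB pairing0 sub0r. Qed.

Lemma pairingD n L g h : pairing n L (g + h) = pairing n L g + pairing n L h.
Proof. by rewrite -[h in LHS]opprK pairingB pairingN opprK. Qed.

Lemma pairing_sum n L (I : Type) (r : seq I) (F : I -> seq bool -> int) :
  pairing n L (\sum_(i <- r) F i) = \sum_(i <- r) pairing n L (F i).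
Proof.
elim/big_rec2: _ => [|i y1 y2 _ IH]; first exact: pairing0.
by rewrite pairingD IH.
Qed.

Lemma pairingMz n L g m : pairing n L (g *~ m) = pairing n L g *~ m.
Proof.
rewrite /pairing mulrz_suml; apply: eq_bigr => v _.
rewrite -mulrzA; congr (_ *~ _).
by rewrite fun_mulzE -mulrzr intz.
Qed.

Lemma pairing_eq0 n L g : (forall v, size v = n -> g v != 0 -> L v = 0) ->
  pairing n L g = 0.
Proof.
move=> h; rewrite /pairing big_seq big1 // => v; rewrite mem_codes => /eqP sv.
by case: (eqVneq (g v) 0) => [->|/h -> //]; rewrite ?mulr0z ?mul0rz.
Qed.

Lemma pairing_delta n L e : size e = n -> pairing n L (fun u => (u == e)%:R) = L e.
Proof.
move=> se; rewrite /pairing (bigD1_seq e) ?uniq_codes ?mem_codes ?se //= eqxx.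
rewrite big1_seq ?addr0 // => u /andP[/negbTE -> _]; exact: mulr0z.
Qed.

Lemma pairing_cobd n L g : pairing n (cobd L) g = pairing n L (simp_bd g).
Proof.
elim: n L g => [|n IH] L g.
  by rewrite /pairing /= !big_seq1 mul0rz mulr0z.
rewrite !pairingS along_true_bd along_false_bd pairingB -!IH.
rewrite addrA addrAC; congr (_ + _); last first.
  by rewrite /pairing; apply: eq_bigr => v _ /=; rewrite subr0.
rewrite /pairing -sumrB; apply: eq_bigr => v _ /=.
by rewrite /card_signed mulrzBl mulrzA.
Qed.

End Pairing.

End Simplices.

Section Support.
Local Open Scope ring_scope.
Implicit Types (e : seq (option bool)) (v u : seq bool).

(** [facet e e1]: the face [e] has codimension one in [e1]. *)
Fixpoint facet e e1 : bool :=
  match e, e1 with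
  | x :: e', y :: e1' =>
      ((x == y) && facet e' e1') || [&& y == None, x != None & e' == e1']
  | _, _ => false
  end.

(** Inclusion of subsets. *)
Definition vle u v := all2 implb u v.

Lemma vle_refl v : vle v v.
Proof. by elim: v => //= -[] v ->. Qed.

Lemma vle_card u v : vle u v -> (u == v) || (count id u < count id v)%N.
Proof.
elim: u v => [|x u IH] [|y v] //= /andP[xy /IH /orP[/eqP <-|]].
  by case: x y xy => -[] //= _; rewrite ?eqxx //; apply/orP; right; lia.
by move=> h; apply/orP; right; case: x y xy => -[] //= _; lia.
Qed.

Lemma vle_size u v : vle u v -> size u = size v.
Proof. by rewrite /vle all2E => /andP[/eqP]. Qed.

Lemma cube_bd_support f e : cube_bd f e != 0 ->
  exists2 e1, f e1 != 0 & facet e e1.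
Proof.
elim: e f => [|x e IH] f //=.
have [h|h _] := eqVneq (cube_bd (along x f) e) 0; last first.
  by have [e1 h1 h2] := IH _ h; exists (x :: e1); rewrite //= eqxx h2.
rewrite h add0r => hx; exists (None :: e).
  by apply: contraNneq hx => ->; case: x {h} => [[]|]; rewrite ?mulr0 ?oppr0.
by case: x hx {h} => [b _|]; rewrite /= ?eqxx ?orbT.
Qed.

Lemma facet_size e e1 : facet e e1 -> size e = size e1.
Proof.
by elim: e e1 => [|x e IH] [|y e1] //= /orP[/andP[_ /IH ->] //|/and3P[_ _ /eqP ->]].
Qed.

Lemma facet_stars e e1 : facet e e1 -> stars e1 = (stars e).+1.
Proof.
elim: e e1 => [|x e IH] [|y e1] //= /orP[/andP[/eqP -> /IH h]|].
  by rewrite /stars /= in h *; rewrite h addnS.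
by case/and3P => /eqP -> hx /eqP ->; rewrite /stars /= (negbTE hx).
Qed.

Lemma facet_top e e1 : facet e e1 -> vle (top e) (top e1).
Proof.
elim: e e1 => [|x e IH] [|y e1] //= /orP[/andP[/eqP -> /IH h]|].
  by rewrite /vle /= -/(vle _ _) h andbT; case: (_ != _).
by case/and3P => /eqP -> hx /eqP ->; rewrite /vle /= -/(vle _ _) vle_refl implybT.
Qed.

(** The contraction only removes vertices from the top of a cube, so it stays in
a simplicial complex. *)
Lemma cube_htpy_support f e : cube_htpy f e != 0 ->
  exists e1, [/\ f e1 != 0, size e = size e1, stars e = (stars e1).+1
               & vle (top e) (top e1)].
Proof.
elim: e f => [|[[]|] e IH] f //=; try by rewrite eqxx.
  move=> /IH[e1 []]; rewrite ?funE => h hs ht hv.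
  have [h0|h0] := eqVneq (f (Some false :: e1)) 0.
    exists (Some true :: e1); rewrite /= hs; split=> //.
    by rewrite /along h0 add0r in h.
  by exists (Some false :: e1); rewrite /= hs; split.
move=> h; exists (Some true :: e); split=> //.
  by apply: contraNneq h => ->; rewrite mulr0.
by rewrite /vle /= -/(vle _ _) vle_refl.
Qed.

Lemma push_origin_support f e : push_origin f e != 0 -> 
  exists2 e1, f e1 != 0 & stars e1 = 0%N.
Proof.
elim: e f => [|[[]|] e IH] f //=; try by rewrite eqxx.
  by move=> h; exists [::].
move=> /IH[e1]; rewrite ?funE => h hs.
have [h0|h0] := eqVneq (f (Some false :: e1)) 0.
  by exists (Some true :: e1) => //; rewrite /along h0 add0r in h.
by exists (Some false :: e1).
Qed.

End Support.

(** * Full cubical complexes of nonempty faces *)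

Section Complex.
Local Open Scope ring_scope.
Variables (A : zmodType) (N k : nat) (L : seq bool -> A).
Implicit Types (v : seq bool) (e : seq (option bool)) (g : seq bool -> int)
  (f : seq (option bool) -> int).

(** The complex [K] of all simplices with at most [k+1] vertices, and of those
with [k+2] vertices on which [L] is closed. *)
Definition in_K v : bool :=
  (size v == N) && ((count id v <= k.+1)%N
                    || ((count id v == k.+2) && (cobd L v == 0))).

(** A cube lies in the cone when its largest vertex is in [K]; it avoids the
empty set when its smallest vertex, the set of coordinates [1], is nonempty. *)
Definition cone_cell j e : bool := (stars e == j) && in_K (top e).

Definition sub_cell j e : bool := cone_cell j e && (Some true \in e).

Lemma in_K_vle u v : vle u v -> in_K v -> in_K u.
Proof.
move=> uv; have su := vle_size uv; case/orP: (vle_card uv) => [/eqP -> //|lt].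
rewrite /in_K su => /andP[-> h] /=; apply/orP; left.
by case/orP: h => [|/andP[/eqP h _]]; lia.
Qed.

Lemma cube_bd_cone j f : supp (cone_cell j.+1) f -> supp (cone_cell j) (cube_bd f).
Proof.
move=> hf e /cube_bd_support[e1 /hf /andP[/eqP s1 K1] fe].
move: (facet_stars fe); rewrite s1 => -[sj].
by rewrite /cone_cell -sj eqxx (in_K_vle (facet_top fe) K1).
Qed.

Lemma cube_htpy_cone j f : supp (cone_cell j) f -> supp (cone_cell j.+1) (cube_htpy f).
Proof.
move=> hf e /cube_htpy_support[e1 [/hf /andP[/eqP s1 K1] _ se te]].
by rewrite /cone_cell se s1 eqxx (in_K_vle te K1).
Qed.

Lemma push_origin_cone j f : supp (cone_cell j.+1) f -> push_origin f = 0.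
Proof.
move=> hf; apply/funext => e; apply: contraTeq isT => /push_origin_support[e1 /hf].
by move=> /andP[/eqP ->].
Qed.

Lemma cube_htpy_fill j f : supp (cone_cell j.+1) f ->
  cube_htpy (cube_bd f) = f - cube_bd (cube_htpy f).
Proof.
move=> hf; have := cube_htpyE f; rewrite (push_origin_cone hf) subr0 => h.
by rewrite -[X in _ = X - _]h addrAC subrr add0r.
Qed.

Lemma sub_cone j f : supp (sub_cell j) f -> supp (cone_cell j) f.
Proof. by apply: supp_sub => e /andP[]. Qed.

Lemma simp_sub j f : supp (sub_cell j) f -> simp f = 0.
Proof.
move=> hf; apply/funext => v; apply: suppP0 hf _.
by rewrite negb_and simplex_code_no_one orbT.
Qed.

Lemma sub_simp j f : supp (cone_cell j) f -> simp f = 0 -> supp (sub_cell j) f.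
Proof.
move=> hf f0 e fe; rewrite /sub_cell hf //=; apply: contraNT fe => e1.
by rewrite -(simplex_code_top e1) -[f _]/(simp f _) f0.
Qed.

Definition simplex_in_K j v := (count id v == j) && in_K v.

Lemma emb_cone j g : supp (simplex_in_K j) g -> supp (cone_cell j) (emb g).
Proof.
move=> hg e; rewrite /emb; case: ifP => // /negbT e1 /hg /andP[/eqP <- K].
by rewrite /cone_cell K -stars_simplex_code simplex_code_top // eqxx.
Qed.

Lemma simp_cone j f : supp (cone_cell j) f -> supp (simplex_in_K j) (simp f).
Proof.
move=> hf v /hf /andP[/eqP <-]; rewrite top_simplex_code => K.
by rewrite /simplex_in_K K stars_simplex_code eqxx.
Qed.

(** [L] is closed on the simplices of [K] with [k+2] vertices, by the choice of
[K]; so it vanishes on their boundaries. *)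
Lemma pairing_top f : supp (cone_cell k.+2) f -> pairing N L (simp_bd (simp f)) = 0.
Proof.
move=> hf; rewrite -pairing_cobd; apply: pairing_eq0 => v sv.
move=> /(simp_cone hf) /andP[/eqP cv /andP[_]]; rewrite cv ltnn /=.
by case/andP => _ /eqP.
Qed.

(** For a cycle [f], the chain [cube_htpy f] fills [f] in the cone; its part
through the empty set is a cycle of [K], with which [L] is paired. *)
Definition theta f : A := pairing N L (simp (cube_htpy f)).

Lemma thetaB f1 f2 : theta (f1 - f2) = theta f1 - theta f2.
Proof. by rewrite /theta cube_htpyB simpB pairingB. Qed.

Lemma theta_bd f : supp (sub_cell k.+1) f -> theta (cube_bd f) = 0.
Proof.
move=> hf; rewrite /theta (cube_htpy_fill (sub_cone hf)).
rewrite simpB (simp_sub hf) simp_cube_bd sub0r pairingN.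
by rewrite pairing_top ?oppr0 //; apply/cube_htpy_cone/sub_cone.
Qed.

(** A cycle [g] of [K], seen as a chain of cubes in the cone, has a boundary that
avoids the empty set; this boundary is the required cycle. *)
Lemma theta_surj : 
  (forall x, exists g, [/\ supp (simplex_in_K k.+1) g, simp_bd g = 0
                         & pairing N L g = x]) ->
  forall x, exists f, [/\ supp (sub_cell k) f, cube_bd f = 0 & theta f = x].
Proof.
move=> hL x; have [g [gK g0 <-]] := hL x.
have eg := emb_cone gK; exists (cube_bd (emb g)); split.
- by apply: sub_simp; [exact: cube_bd_cone | rewrite -simp_bdE].
- exact: cube_bdK.
rewrite /theta (cube_htpy_fill eg) simpB simp_emb simp_cube_bd pairingB.
by rewrite pairing_top ?subr0 //; exact: cube_htpy_cone.
Qed.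

Hypothesis k_gt0 : (0 < k)%N.

(** The filling of [f] in the cone has a simplicial part that bounds in [K];
subtracting the boundary of a simplicial chain pushes the filling off the empty
set. *)
Lemma theta_inj :
  (forall g, supp (simplex_in_K k.+1) g -> simp_bd g = 0 -> pairing N L g = 0 ->
     exists2 h, supp (simplex_in_K k.+2) h & simp_bd h = g) ->
  forall f, supp (sub_cell k) f -> cube_bd f = 0 -> theta f = 0 ->
  exists2 w, supp (sub_cell k.+1) w & cube_bd w = f.
Proof.
move=> hL f hf f0 tf0; pose c := cube_htpy f.
have cK : supp (cone_cell k.+1) c by exact/cube_htpy_cone/sub_cone.
have cf : cube_bd c = f.
  have := cube_htpyE f; rewrite f0 (_ : cube_htpy 0 = 0); last first.
    by rewrite -[X in cube_htpy X](subrr 0) cube_htpyB subrr.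
  rewrite addr0 -/c => ->; rewrite (@push_origin_cone k.-1) ?subr0 //.
  by rewrite prednK //; exact: sub_cone.
have sc0 : simp_bd (simp c) = 0 by rewrite -simp_cube_bd cf (simp_sub hf).
have [h hK hc] := hL _ (simp_cone cK) sc0 tf0.
exists (c - cube_bd (emb h)); last by rewrite cube_bdB cube_bdK subr0.
apply: sub_simp; first by apply: suppB => //; exact/cube_bd_cone/emb_cone.
by rewrite simpB -simp_bdE hc subrr.
Qed.

End Complex.

(** * Cochains that present a group *)

Section Presents.
Local Open Scope ring_scope.
Variable A : zmodType.
Implicit Types (v : seq bool) (g h : seq bool -> int) (L : seq bool -> A).

Definition simplex n j v : bool := (size v == n) && (count id v == j).

(** [L] identifies [A] with the group that has the [k]-simplices as generators and
two kinds of relations: simplices with value [0] are trivial, and so are boundaries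
of [(k+1)]-simplices on which [L] is closed. *)
Definition presents n k L : Prop :=
  (forall x, exists2 g, supp (simplex n k.+1) g & pairing n L g = x) /\
  (forall g, supp (simplex n k.+1) g -> pairing n L g = 0 ->
     exists h t, [/\ g = h + simp_bd t,
       supp (fun v => simplex n k.+1 v && (L v == 0)) h
     & supp (fun v => simplex n k.+2 v && (cobd L v == 0)) t]).

(** Extension by zero to one more vertex: to the simplices through it for
[b = true], to the simplices avoiding it for [b = false]. *)
Definition extend (V : zmodType) (b : bool) (f : seq bool -> V) v : V :=
  if v is x :: u then (if x == b then f u else 0) else 0.

Lemma extendE (V : zmodType) b (f : seq bool -> V) v : extend b f (b :: v) = f v.
Proof. by rewrite /extend eqxx. Qed.

Lemma extendNE (V : zmodType) (b c : bool) (f : seq bool -> V) v : c <> b -> extend b f (c :: v) = 0.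
Proof. by move=> /eqP/negbTE h; rewrite /extend h. Qed.

Lemma along_extend b g : along b (extend b g) = g.
Proof. by apply/funext => v; rewrite /along extendE. Qed.

Lemma along_extendN b g : along (~~ b) (extend b g) = 0.
Proof. by apply/funext => v; rewrite /along extendNE //; case: b. Qed.

Lemma pairing_extend n b L g : pairing n.+1 (extend b L) g = pairing n L (along b g).
Proof.
rewrite pairingS.
have h0 c : c <> b -> pairing n (fun u => extend b L (c :: u)) (along c g) = 0.
  by move=> cb; apply: pairing_eq0 => v _ _; rewrite extendNE.
have h1 : pairing n (fun u => extend b L (b :: u)) (along b g) = pairing n L (along b g).
  by apply: eq_bigr => v _; rewrite extendE.
by case: b h0 h1 => h0 ->; rewrite h0 // ?addr0 ?add0r.
Qed.

Lemma cobd0 v : cobd (fun _ => 0 : A) v = 0.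
Proof. by elim: v => //= -[] v ->; rewrite ?mul0rz subr0. Qed.

Lemma cobd_extend b L v : cobd (extend b L) (b :: v) = cobd L v.
Proof.
rewrite /= (_ : (fun u => extend b L (b :: u)) = L).
  by case: b => //; rewrite ?extendNE // ?mul0rz subr0.
by apply/funext => u; rewrite extendE.
Qed.

Lemma cobd_extend_cone L v : cobd (extend false L) (true :: v) = - (L v *~ card_sign v).
Proof.
by rewrite /= cobd0 sub0r.
Qed.

Lemma simp_bd_simplex n j g : supp (simplex n j.+1) g -> supp (simplex n j) (simp_bd g).
Proof.
move=> gs v; rewrite simp_bdE => /cube_bd_support[e].
rewrite /emb; case: ifP => // /negbT ne /gs; rewrite /simplex size_map => /andP[/eqP <- ct] fe.
rewrite -(size_simplex_code v) (facet_size fe) eqxx /=.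
have := facet_stars fe; rewrite stars_simplex_code -(simplex_code_top ne).
by rewrite stars_simplex_code (eqP ct) => -[->].
Qed.

Lemma supp_along n j (b : bool) g : supp (simplex n.+1 j) g ->
  supp (fun v => (size v == n) && (b + count id v == j)%N) (along b g).
Proof. by move=> hg v /hg. Qed.

(** The new vertex belongs to all simplices that carry a nonzero value.  All
other [k]-simplices are trivial, so the faces opposite to the new vertex do not
contribute to the relations. *)
Lemma presents_suspension n k L : presents n k L -> presents n.+1 k.+1 (extend true L).
Proof.
move=> [surj inj]; split=> [x|g gs].
  have [g gs <-] := surj x; exists (extend true g).
    move=> [|[] v]; first by rewrite eqxx.
      by rewrite extendE => /gs; rewrite /simplex /=.
    by rewrite extendNE // eqxx.
  by rewrite pairing_extend along_extend.
rewrite pairing_extend => g0.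
have [|h [t [gE hs ts]]] := inj (along true g) _ g0; first exact: supp_along gs.
exists (g - simp_bd (extend true t)), (extend true t); split; first by rewrite subrK.
  move=> [|[] v].
  - by rewrite ?funE /= subr0 => /gs.
  - rewrite ?funE extendE => hv; have : h v != 0.
      move: hv; rewrite /= along_extend subr0 -[g _]/(along true g v) gE ?funE addrK.
      by [].
    by move/hs; rewrite /simplex /=.
  have bE : simp_bd (extend true t) (false :: v) = - (card_sign v * t v).
    rewrite -[LHS]/(along false _ v) along_false_bd (along_extendN true) simp_bd0.
    by rewrite along_extend sub0r.
  rewrite ?funE bE opprK extendNE // eqxx andbT => hv.
  have [/gs //|/ts] : g (false :: v) != 0 \/ t v != 0.
    have [g0'|] := eqVneq (g (false :: v)) 0; [right | by left].
    by apply: contraNneq hv => ->; rewrite g0' mulr0.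
  by rewrite /simplex /= => /andP[].
move=> [|[] v]; first by rewrite eqxx.
  by rewrite extendE cobd_extend => /ts; rewrite /simplex /=.
by rewrite extendNE // eqxx.
Qed.

(** The new vertex is the apex of a cone over the full [k]-skeleton: a [k]-cycle
is determined by its part [g] avoiding the apex, which is arbitrary, the part
through the apex being the cone over the boundary of [g].  The coboundary of the
extended cochain at a simplex through the apex is, up to sign, the value of [L]
at the opposite face, so both kinds of relations in [presents] are boundaries of
[(k+1)]-simplices of [K]. *)
Lemma presents_cone n k L : presents n k L ->
  let N := n.+1 in let L' := extend false L in
  (forall x, exists g, [/\ supp (simplex_in_K N k L' k.+1) g, simp_bd g = 0
                         & pairing N L' g = x]) /\
  (forall g, supp (simplex_in_K N k L' k.+1) g -> simp_bd g = 0 -> pairing N L' g = 0 ->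
     exists2 h, supp (simplex_in_K N k L' k.+2) h & simp_bd h = g).
Proof.
move=> [surj inj] N L'; split=> [x|g gs bg0].
  have [g gs <-] := surj x.
  exists (extend false g + extend true (card_signed (simp_bd g))).
  have a0 : along false (extend false g + extend true (card_signed (simp_bd g))) = g.
    by rewrite -[LHS]/(along _ _ + along _ _) along_extend (along_extendN true) addr0.
  have a1 : along true (extend false g + extend true (card_signed (simp_bd g)))
      = card_signed (simp_bd g).
    by rewrite -[LHS]/(along _ _ + along _ _) along_extend (along_extendN false) add0r.
  split.
  - move=> v hv; rewrite /simplex_in_K /in_K.
    suff /andP[-> /eqP ->] : simplex N k.+1 v by rewrite eqxx leqnn.
    case: v hv => [|[] v].
    + by [].
    + rewrite -[X in X != 0]/(along true (_ + _) v) a1 /card_signed => hv.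
      have : simp_bd g v != 0 by apply: contraNneq hv => ->; rewrite mulr0.
      by move=> /(simp_bd_simplex gs); rewrite /simplex /= !eqSS.
    by rewrite -[X in X != 0]/(along false (_ + _) v) a0 => /gs.
  - apply: along_eq => //.
      by rewrite along_false_bd a0 a1 card_signedK subrr.
    by rewrite along_true_bd a1 simp_bd_signed simp_bdK; apply/funext=> v; rewrite ?funE /card_signed mulr0 oppr0.
  by rewrite pairing_extend a0.
rewrite pairing_extend => g0.
have gs' : supp (simplex N k.+1) g by move=> v /gs /andP[cv /andP[sv _]]; rewrite /simplex sv cv.
have [|h [t [gE hs ts]]] := inj (along false g) _ g0; first exact: supp_along gs'.
pose d := extend false t - extend true (card_signed h).
have d0 : along false d = t.
  by rewrite -[LHS]/(along _ _ - along _ _) along_extend (along_extendN true) subr0.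
have d1 : along true d = - card_signed h.
  by rewrite -[LHS]/(along _ _ - along _ _) along_extend (along_extendN false) sub0r.
have dN : d [::] = 0 by rewrite /d ?funE subrr.
exists d.
  move=> [|[] v]; first by rewrite dN eqxx.
    rewrite -[X in X != 0]/(along true d v) d1 ?funE => hv.
    have /hs : h v != 0.
      by apply: contraNneq hv => hv0; rewrite /card_signed hv0 mulr0 oppr0.
    rewrite /simplex => /andP[/andP[/eqP sv /eqP cv] /eqP Lv].
    by rewrite /simplex_in_K /in_K cobd_extend_cone Lv mul0rz oppr0 /= sv cv add1n !eqxx orbT.
  rewrite -[X in X != 0]/(along false d v) d0 => tv; have := ts _ tv.
  rewrite /simplex => /andP[/andP[/eqP sv /eqP cv] /eqP Lv].
  by rewrite /simplex_in_K /in_K cobd_extend Lv /= sv cv add0n !eqxx orbT.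
have b0 : simp_bd (along false g) = card_signed (along true g).
  by apply/eqP; rewrite -subr_eq0 -along_false_bd bg0.
apply: along_eq.
- rewrite along_false_bd d0 d1 gE addrC; congr (_ + _).
  by rewrite card_signedN opprK card_signedK.
- rewrite along_true_bd d1 simp_bdN simp_bd_signed opprK -[RHS]card_signedK -b0 gE.
  by rewrite simp_bdD simp_bdK addr0.
rewrite /=; apply/esym; apply: suppP0 gs' _.
by rewrite /simplex.
Qed.

End Presents.

(** * Finite additive presentations of finitely generated groups *)

Section Subgroups.
Local Open Scope ring_scope.

Definition subgroup (Z : zmodType) (D : Z -> Prop) : Prop :=
  D 0 /\ forall x y, D x -> D y -> D (x - y).

Variables (Z : zmodType) (D : Z -> Prop).
Hypothesis Dsub : subgroup D.

Lemma subgroupB x y : D x -> D y -> D (x - y).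
Proof. exact: Dsub.2. Qed.

Lemma subgroupN x : D x -> D (- x).
Proof. by move=> h; rewrite -sub0r; apply: subgroupB => //; exact: Dsub.1. Qed.

Lemma subgroupD x y : D x -> D y -> D (x + y).
Proof. by move=> h1 h2; rewrite -[y]opprK; apply/subgroupB/subgroupN. Qed.

Lemma subgroupMz x m : D x -> D (x *~ m).
Proof.
move=> h; elim/int_ind: m => [|m IH|m IH]; first by rewrite mulr0z; exact: Dsub.1.
  by rewrite -addn1 PoszD mulrzDr; exact: subgroupD.
by rewrite -addn1 PoszD opprD mulrzDr; apply: subgroupB.
Qed.

Lemma subgroup_sym x y : D (x - y) -> D (y - x).
Proof. by move/subgroupN; rewrite opprB. Qed.

Lemma subgroup_trans y x z : D (x - y) -> D (y - z) -> D (x - z).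
Proof. by move=> h /(subgroupD h); rewrite addrA subrK. Qed.

Lemma subgroup_sum (I : Type) (r : seq I) (F : I -> Z) :
  (forall i, D (F i)) -> D (\sum_(i <- r) F i).
Proof.
by move=> h; elim/big_rec: _ => [|i x _ hx]; [exact: Dsub.1 | exact: subgroupD].
Qed.

End Subgroups.

Lemma supp_subgroup (T : Type) (P : pred T) :
  subgroup (fun f : T -> int => supp P f).
Proof. by split=> [x|f g]; [rewrite eqxx | exact: suppB]. Qed.

Section Noetherian.
Local Open Scope ring_scope.
Implicit Types (x r : nat -> int).

(** [Z^n] is Noetherian: an element of [K] with least nonzero last coordinate
generates [K] modulo the elements with last coordinate zero.  The conclusion is
stated through subgroups that contain the generators. *)
Lemma subgroup_finitely_generated n (K : (nat -> int) -> Prop) :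
  subgroup K -> (forall x, K x -> forall i, (n <= i)%N -> x i = 0) ->
  exists R : seq (nat -> int), (forall r, List.In r R -> K r) /\
    forall D, subgroup D -> (forall r, List.In r R -> D r) -> forall x, K x -> D x.
Proof.
elim: n K => [|n IH] K Ksub Kn.
  exists [::]; split=> // D Dsub _ x Kx.
  by rewrite (_ : x = 0); [exact: Dsub.1 | apply/funext => i; rewrite Kn].
pose K' x := K x /\ x n = 0.
have K'sub : subgroup K'.
  split=> [|x y [Kx x0] [Ky y0]]; first by split=> //; exact: Ksub.1.
  by split; [exact: subgroupB | rewrite ?funE x0 y0].
have K'n x : K' x -> forall i, (n <= i)%N -> x i = 0.
  move=> [Kx x0] i; rewrite leq_eqVlt => /orP[/eqP <- //|]; exact: Kn.
have [R [RK RD]] := IH K' K'sub K'n.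
have [K0|] := pselect (forall x, K x -> x n = 0).
  exists R; split=> [r /RK[] //|D Dsub h x Kx].
  by apply: RD => //; split=> //; exact: K0.
move=> /existsNP[x0 /not_implyP[Kx0 /eqP x0n]].
have ex : exists m, `[< exists2 x, K x & (x n != 0) && (`|x n|%N == m) >].
  by exists `|x0 n|%N; apply/asboolP; exists x0; rewrite ?eqxx ?x0n.
case: (ex_minnP ex) => m /asboolP[r Kr /andP[rn0 /eqP rm]] mmin.
exists (r :: R); split=> [s [<- //|/RK[] //]|D Dsub h x Kx].
pose q := (x n %/ r n)%Z.
have Kq : K (x - r *~ q) by apply: subgroupB => //; exact: subgroupMz.
have rq i : (r *~ q) i = r i * q by rewrite fun_mulzE -mulrzr intz.
have Dq : D (x - r *~ q).
  apply: RD => //; first by move=> s sR; apply: h; right.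
  split=> //; rewrite ?funE rq; apply: contraTeq isT => ne.
  have e : x n - r n * q = (x n %% r n)%Z by rewrite /modz mulrC.
  have /mmin : `[< exists2 y, K y & (y n != 0) && (`|y n|%N == `|(x n %% r n)%Z|%N) >].
    apply/asboolP; exists (x - r *~ q) => //.
    by rewrite ?funE rq e eqxx andbT -e.
  have := ltz_mod (x n) rn0; have := modz_ge0 (x n) rn0; rewrite -rm; lia.
rewrite -[x](subrK (r *~ q)); apply: subgroupD => //.
by apply: subgroupMz => //; apply: h; left.
Qed.

End Noetherian.

Section Presentation.
Local Open Scope ring_scope.

(** The second part is the universal property of the presentation with
generators [I] and relations [v x + v y = v z], tested on a quotient of [Z] by a
subgroup [D]. *)
Definition additively_presented (A : zmodType) (I : finType) (v : I -> A) : Prop :=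
  (forall a, exists c : I -> int, a = \sum_x v x *~ c x) /\
  forall (Z : zmodType) (D : Z -> Prop) (g : I -> Z), subgroup D ->
    (forall x y z, v x + v y = v z -> D (g x + g y - g z)) ->
    forall c : I -> int, \sum_x v x *~ c x = 0 -> D (\sum_x g x *~ c x).

(** Let [M] bound the coefficients of a finite set of defining relations, and
take for [I] the box of all vectors with coefficients at most [M].  Sums within
the box already force [G d], the image of a vector [d], to be the linear
combination of the images of the unit vectors; applied to a defining relation,
which lies in the box and has the same value as [0], this shows that the
relation holds. *)
Lemma additive_presentation (A : zmodType) : finitely_generated A ->
  exists (I : finType) (v : I -> A), additively_presented v.
Proof.
move=> [s sgen]; set n := size s in sgen.
pose ev (c : nat -> int) : A := \sum_(i < n) s`_i *~ c i.
have evB c d : ev (c - d) = ev c - ev d.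
  by rewrite /ev -sumrB; apply: eq_bigr => i _; rewrite ?funE mulrzBr.
pose K c := ev c = 0 /\ forall i, (n <= i)%N -> c i = 0.
have Ksub : subgroup K.
  split=> [|c d [c0 cn] [d0 dn]].
    by split=> //; rewrite /ev big1 // => i _; rewrite ?funE mulr0z.
  split; first by rewrite evB c0 d0 subrr.
  by move=> i ni; rewrite ?funE cn // dn // subrr.
have [R [RK RD]] := subgroup_finitely_generated Ksub (fun x h => h.2).
pose M := (\max_(r <- R) \max_(i < n) `|r i|%N).+1.
have RM r i : List.In r R -> (`|r i| <= M)%N.
  move=> rR; have [ni|/(RK _ rR).2 -> //] := ltnP i n.
  apply: leqW; apply: leq_trans (leq_bigmax (F := fun i : 'I_n => `|r i|%N) (Ordinal ni)) _.
  rewrite /M; elim: R rR {RK RD M} => //= r' R IHR [->|rR]; rewrite big_cons.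
    exact: leq_maxl.
  by apply: leq_trans (IHR rR) _; exact: leq_maxr.
pose I : finType := {ffun 'I_n -> 'I_(M + M).+1}.
(* Box vectors are encoded with coefficients shifted by [M]. *)
pose co (x : I) : nat -> int := fun i => if insub i is Some j then (x j)%:Z - M%:Z else 0.
pose v (x : I) := ev (co x).
pose box (c : nat -> int) := (forall i, (`|c i| <= M)%N) /\ forall i, (n <= i)%N -> c i = 0.
have coB x : box (co x).
  split=> i; rewrite /co.
    by case: insubP => [j _ _|//]; have := ltn_ord (x j); lia.
  by move=> ni; rewrite insubF // ltnNge ni.
have coS c : box c -> exists x, co x = c.
  move=> [cM cn]; exists [ffun i => inord (absz (c (nat_of_ord i) + M%:Z))]; apply/funext=> i.
  rewrite /co; case: insubP => [j _ /= <-|]; last by rewrite -leqNgt => /cn.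
  rewrite ffunE inordK; have := cM (nat_of_ord j); lia.
have evco x : v x = ev (co x) by [].
pose e i : nat -> int := fun j => (i == j)%:R.
have boxe (i : 'I_n) : box (e i).
  by split=> j; rewrite /e; case: eqP => // <-; rewrite leqNgt ltn_ord.
have sume (V : zmodType) (F : nat -> V) (i : 'I_n) : \sum_(j < n) F j *~ e i j = F i.
  rewrite (bigD1 i) //= /e eqxx mulr1z big1 ?addr0 // => j ji.
  by rewrite eq_sym (_ : (nat_of_ord j == i) = false) ?mulr0z //; exact: negbTE.
exists I, v; split=> [a|Z D g Dsub gadd c].
  have eX (i : 'I_n) : exists x : I, co x = e i by exact: coS.
  have [xi xiE] := choice eX.
  have [d ->] := sgen a.
  exists (fun x => \sum_(i < n | xi i == x) d i).
  transitivity (\sum_x \sum_(i < n | xi i == x) v (xi i) *~ d i).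
    rewrite (exchange_big_dep xpredT) //=; apply: eq_bigr => i _.
    rewrite (big_pred1 (xi i)) => [|x]; last by rewrite eq_sym.
    by rewrite /v xiE /ev (sume _ (fun j => s`_j)).
  apply: eq_bigr => x _; rewrite mulrz_sumr; apply: eq_bigr => i /eqP -> //.
have sumB (F : nat -> Z) (c1 c2 : nat -> int) :
    \sum_(i < n) F i *~ (c1 - c2) i = \sum_(i < n) F i *~ c1 i - \sum_(i < n) F i *~ c2 i.
  by rewrite -sumrB; apply: eq_bigr => i _; rewrite ?funE mulrzBr.
have box0 : box 0 by split.
have [x0 _] := coS 0 box0.
have idxP d : exists x, box d -> co x = d.
  by have [/coS[x <-]|nb] := pselect (box d); [exists x | exists x0].
have [idx idxE] := choice idxP.
pose G d := g (idx d).
have vidx d : box d -> v (idx d) = ev d by move=> bd; rewrite evco idxE.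
have Gadd d1 d2 : box d1 -> box d2 -> box (d1 - d2) -> D (G (d1 - d2) + G d2 - G d1).
  by move=> b1 b2 b12; apply: gadd; rewrite !vidx // evB subrK.
have G0 x : v x = 0 -> D (g x).
  move=> vx; rewrite -[g x](addrK (g x)); apply: gadd.
  by rewrite vx addr0.
(* Induction on the [l^1]-norm, adding or removing one unit vector at a time. *)
have Gsum d : box d -> D (G d - \sum_(i < n) G (e i) *~ d i).
  have [m] := ubnP (\sum_(i < n) absz (d i))%N; elim: m d => // m IH d dm bd.
  have [d0|] := pselect (forall i : 'I_n, d i = 0).
    rewrite big1 ?subr0 => [|i _]; last by rewrite d0 mulr0z.
    by apply: G0; rewrite vidx // /ev big1 // => i _; rewrite d0 mulr0z.
  move=> /existsNP[i /eqP di].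
  have bi := boxe i.
  have lt_m d' : (absz (d' i) < absz (d i))%N ->
      (forall j : 'I_n, j != i -> d' j = d j) -> (\sum_(j < n) absz (d' j) < m)%N.
    move=> lt eq; apply: leq_trans (dm : (_ <= m)%N).
    rewrite (bigD1 i) //= [X in (_ < X)%N](bigD1 i) //= (eq_bigr (fun j : 'I_n => absz (d j))).
      by rewrite ltn_add2r.
    by move=> j /eq ->.
  have eqi : e i i = 1 by rewrite /e eqxx.
  have eji (j : 'I_n) : j != i -> e i j = 0.
    by rewrite /e eq_sym => /negbTE ji; rewrite (_ : (nat_of_ord i == j) = false).
  have eout j : (n <= j)%N -> e i j = 0 by exact: bi.2.
  have [dpos|dneg] : 0 < d i \/ d i < 0 by lia.
    have bd' : box (d - e i).
      split=> j; rewrite ?funE; last by move=> nj; rewrite bd.2 // eout ?subr0.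
      rewrite /e; case: eqP => [<-|_]; have := bd.1 i; have := bd.1 j; lia.
    have /IH/(_ bd') : (\sum_(j < n) absz ((d - e i)%R j) < m)%N.
      by apply: lt_m => [|j ji]; rewrite ?funE ?eqi ?eji ?subr0 //; lia.
    have := sumB (fun j => G (e j)) d (e i); rewrite (sume _ (fun j => G (e j))) => -> h.
    rewrite opprB addrA in h.
    exact: (subgroup_trans Dsub (subgroup_sym Dsub (Gadd _ _ bd bi bd')) h).
  pose d' := d + e i; have dE : d' - e i = d by rewrite addrK.
  have bd' : box d'.
    split=> j; rewrite /d' ?funE; last by move=> nj; rewrite bd.2 // eout ?addr0.
    rewrite /e; case: eqP => [<-|_]; have := bd.1 i; have := bd.1 j; lia.
  have /IH/(_ bd') h : (\sum_(j < n) absz (d' j) < m)%N.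
    by apply: lt_m => [|j ji]; rewrite /d' ?funE ?eqi ?eji ?addr0 //; lia.
  have := sumB (fun j => G (e j)) d' (e i); rewrite dE (sume _ (fun j => G (e j))) => ->.
  have := Gadd d' (e i) bd' bi; rewrite dE => /(_ bd) h'.
  by rewrite opprB addrA; exact: (subgroup_trans Dsub h' h).
pose r i := \sum_x co x i * c x.
move=> c0; have Dr : D (\sum_(i < n) G (e i) *~ r i).
  apply: (RD (fun r => D (\sum_(i < n) G (e i) *~ r i))).
  - split=> [|r1 r2 D1 D2]; first by rewrite big1 //; exact: Dsub.1.
    by have := sumB (fun j => G (e j)) r1 r2 => ->; exact: subgroupB.
  - move=> r1 r1R; have [r10 r1n] := RK _ r1R.
    have b1 : box r1 by split=> // i; exact: RM.
    have h1 : D (G r1) by apply: G0; rewrite vidx.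
    by have := subgroupB Dsub h1 (Gsum _ b1); rewrite subKr.
  split; last by move=> i ni; rewrite /r big1 // => x _; rewrite (coB x).2 ?mul0r.
  rewrite /ev -[RHS]c0 /r; under eq_bigr do rewrite mulrz_sumr.
  rewrite exchange_big /=; apply: eq_bigr => x _; rewrite /v /ev mulrz_suml.
  by apply: eq_bigr => i _; rewrite mulrzA.
have gx x : D (g x - \sum_(i < n) G (e i) *~ co x i).
  have gGx : D (g x - G (co x)).
    have h0 : D (G 0) by apply: G0; rewrite vidx // /ev big1 // => i _; rewrite mulr0z.
    have h1 : D (g x + G 0 - G (co x)).
      apply: gadd; rewrite (vidx 0) // (vidx (co x)); last exact: coB.
      rewrite evco [X in _ + X](_ : _ = 0) ?addr0 //.
      by rewrite /ev big1 // => i _; rewrite mulr0z.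
    by have := subgroupB Dsub h1 h0; rewrite addrAC addrK.
  exact: (subgroup_trans Dsub gGx (Gsum _ (coB x))).
have : D (\sum_x (g x - \sum_(i < n) G (e i) *~ co x i) *~ c x).
  by apply: subgroup_sum => // x; apply: subgroupMz.
move/(subgroupD Dsub)/(_ Dr).
under eq_bigr do rewrite mulrzBl.
rewrite sumrB; rewrite (_ : \sum_x (\sum_(i < n) G (e i) *~ co x i) *~ c x = \sum_(i < n) G (e i) *~ r i) ?subrK //.
rewrite /r; under [RHS]eq_bigr do rewrite mulrz_sumr.
rewrite exchange_big /=; apply: eq_bigr => x _; rewrite mulrz_suml.
by apply: eq_bigr => i _; rewrite mulrzA.
Qed.

End Presentation.

(** * Simplices as subsequences of a list of vertices *)

Section Mask.
Local Open Scope ring_scope.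

Lemma mask_inj (V : eqType) (s : seq V) (c e : bitseq) :
  uniq s -> size c = size s -> size e = size s -> mask c s = mask e s -> c = e.
Proof.
elim: s c e => [|p s IH] [|x c] [|y e] //= /andP[ps us] [sc] [se].
case: x y => -[] // h; first by case: h => /IH ->.
- by move: ps; rewrite (mem_mask (m := e)) // -h inE eqxx.
- by move: ps; rewrite (mem_mask (m := c)) // h inE eqxx.
by rewrite (IH c e).
Qed.

(** The coboundary of a cochain given on ordered lists of vertices; its signs, which
count the entries after the missing one, agree with those of [cobd] and [simp_bd]. *)
Fixpoint list_cobd (V : Type) (B : zmodType) (F : seq V -> B) (m : seq V) : B :=
  if m is p :: m' then
    list_cobd (fun u => F (p :: u)) m' - F m' *~ (-1) ^+ size m'
  else 0.

Lemma cobd_mask (V : Type) (B : zmodType) (F : seq V -> B) s e :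
  size e = size s ->
  cobd (fun u => F (mask u s)) e = list_cobd F (mask e s).
Proof.
elim: s e F => [|p s IH] [|x e] F //= [se].
case: x => /=; last by rewrite subr0 IH.
by rewrite (IH _ (fun u => F (p :: u))) // size_mask.
Qed.

Lemma eq_list_cobd (V : eqType) (B : zmodType) (F G : seq V -> B) m :
  (forall u, subseq u m -> F u = G u) -> list_cobd F m = list_cobd G m.
Proof.
elim: m F G => //= p m IH F G h; rewrite (IH _ (fun u => G (p :: u))).
  by rewrite (h m) //; exact: subseq_cons.
by move=> u um; apply: h; rewrite /= eqxx.
Qed.

Lemma list_cobd0 (V : Type) (B : zmodType) m : list_cobd (fun _ : seq V => 0 : B) m = 0.
Proof. by elim: m => //= p m ->; rewrite mul0rz subr0. Qed.

(** The entries of [s] being distinct, a simplex is determined by its list of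
vertices, and its facets are obtained by deleting one entry. *)
Lemma simp_bd_delta (V : eqType) (s : seq V) c e :
  uniq s -> size c = size s -> size e = size s ->
  simp_bd (fun u => (u == c)%:R) e = list_cobd (fun m => (mask e s == m)%:R) (mask c s).
Proof.
elim: s c e => [|p s IH] [|x c] [|y e] //= /andP[ps us] [sc] [se].
have notin (b : bitseq) u : (mask b s == p :: u) = false.
  apply/negbTE; apply: contraNneq ps => h.
  by apply: (mem_mask (m := b)); rewrite h inE eqxx.
have d1 : along x (fun u => (u == x :: c)%:R : int) = (fun u => (u == c)%:R).
  by apply/funext => u; rewrite /along eqseq_cons eqxx.
have dN b : b != x -> along b (fun u => (u == x :: c)%:R : int) = 0.
  by move=> bx; apply/funext => u; rewrite /along eqseq_cons (negbTE bx).
case: x y d1 dN => -[] d1 dN /=.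
- rewrite d1 subr0 IH //=; rewrite (eq_sym _ (mask c s)) notin mul0rz subr0.
  by apply: eq_list_cobd => u _; rewrite eqseq_cons eqxx.
- rewrite dN // simp_bd0 eqseq_cons eqxx /=.
  rewrite (_ : (fun u => _) = fun _ => 0); last first.
    by apply/funext => u; rewrite notin.
  rewrite list_cobd0 size_mask //.
  have -> : (mask e s == mask c s) = (e == c).
    by apply/eqP/eqP => [/mask_inj -> //|->].
  case: (eqVneq e c) => [->|]; last by rewrite mulr0 mul0rz.
  by rewrite mulr1 intz.
- rewrite dN // simp_bd0 subr0; apply/esym.
  rewrite (@eq_list_cobd _ _ _ (fun _ => 0)) ?list_cobd0 // => u um.
  rewrite (_ : (_ == _) = false) //; apply/negbTE; apply: contraNneq ps => pu.
  by apply: (mem_mask (m := c)); apply: (mem_subseq um); rewrite -pu inE eqxx.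
by rewrite d1 ?mulr0n mulr0 subr0 IH.
Qed.

End Mask.

(** * A labelled graph that presents a group *)

(** The vertex [VO] is joined to [VM x] by an edge with label [v x], which stands
for the generator [x].  In a relation [v x + v y = v z], the triangle on [VO],
[VM x] and [VR x y z] has sides with labels [v x], [v y] and [v z].  The vertices
[VU] and [VN x] serve to compare the last two sides with the generators [y] and
[z]. *)
Inductive vert (I : Type) : Type :=
| VO
| VM of I
| VU
| VN of I
| VR of I & I & I.

Arguments VO {I}.
Arguments VU {I}.

HB.instance Definition _ (I : Type) := gen_eqMixin (vert I).

Section LabelledGraph.
Local Open Scope ring_scope.
Variables (A : zmodType) (I : finType) (v : I -> A).
Local Notation V := (vert I).
Implicit Types (p q r : V) (e : seq bool) (f g h : seq bool -> int).

Definition label p q : A :=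
  match p, q with
  | VO, VM x | VO, VN x | VU, VN x => v x
  | VO, VR _ _ z => v z
  | VU, VR _ y _ => v y
  | VM x, VR x' y _ => if x == x' then v y else 0
  | _, _ => 0
  end.

(** The order of the list matters, as a simplex is a subsequence of it and [label]
is only used on pairs in this order. *)
Definition verts : seq V :=
  [:: VO] ++ map (@VM I) (enum I) ++ [:: VU] ++ map (@VN I) (enum I)
  ++ [seq VR t.1.1 t.1.2 t.2 | t <- enum {: I * I * I}].

Lemma uniq_verts : uniq verts.
Proof.
have uM : uniq (map (@VM I) (enum I)).
  by rewrite map_inj_uniq ?enum_uniq // => x y [].
have uN : uniq (map (@VN I) (enum I)).
  by rewrite map_inj_uniq ?enum_uniq // => x y [].
have uR : uniq [seq VR t.1.1 t.1.2 t.2 | t <- enum {: I * I * I}].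
  by rewrite map_inj_uniq ?enum_uniq // => -[[x y] z] [[x' y'] z'] [/= -> -> ->].
pose tag (p : V) : nat :=
  match p with VO => 0 | VM _ => 1 | VU => 2 | VN _ => 3 | VR _ _ _ => 4 end.
have catU i (s t : seq V) : uniq s -> uniq t -> all (fun p => tag p == i) s ->
    all (fun p => i < tag p)%N t -> uniq (s ++ t).
  move=> us ut /allP si /allP ti; rewrite cat_uniq us ut andbT.
  apply/hasPn => p /ti; apply: contraTN => /si /eqP ->; by rewrite ltnn.
apply: (catU 0) => //; last by rewrite all_cat /= all_cat !all_map !all_predT.
apply: (catU 1) => //; last by rewrite /= all_cat !all_map !all_predT.
  apply: (catU 2) => //; last by rewrite all_cat !all_map !all_predT.
  by apply: (catU 3) => //; rewrite all_map all_predT.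
by rewrite all_map all_predT.
Qed.

Lemma mem_VM x : VM x \in map (@VM I) (enum I).
Proof. by rewrite map_f ?mem_enum. Qed.
Lemma mem_VN x : VN x \in map (@VN I) (enum I).
Proof. by rewrite map_f ?mem_enum. Qed.
Lemma mem_VR x y z : VR x y z \in [seq VR t.1.1 t.1.2 t.2 | t <- enum {: I * I * I}].
Proof. by apply/mapP; exists (x, y, z); rewrite ?mem_enum. Qed.

Definition nverts := size verts.

Definition edge_label e : A :=
  if mask e verts is [:: p; q] then label p q else 0.

Definition edge p q : seq bool -> int :=
  fun e => ((size e == nverts) && (mask e verts == [:: p; q]))%:R.

Lemma edge_out p q e : size e != nverts -> edge p q e = 0.
Proof. by rewrite /edge => /negbTE ->. Qed.

Lemma edge_simplex p q : supp (simplex nverts 2) (edge p q).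
Proof.
move=> e; rewrite /edge; case: andP => // -[/eqP se /eqP me] _.
by rewrite /simplex se -(size_mask se) me !eqxx.
Qed.

Lemma edge_delta e p q : size e = nverts -> mask e verts = [:: p; q] ->
  edge p q = (fun u => (u == e)%:R).
Proof.
move=> se me; apply/funext => u; rewrite /edge -me.
have [su|su] := eqVneq (size u) nverts; last first.
  by case: (u =P e) => // ue; rewrite ue se eqxx in su.
by congr (nat_of_bool _)%:R; apply/eqP/eqP => [|-> //]; apply: mask_inj => //; exact: uniq_verts.
Qed.

(** The chains that both kinds of relations in [presents] make trivial. *)
Definition negligible f : Prop := exists h t, [/\ f = h + simp_bd t,
   supp (fun e => simplex nverts 2 e && (edge_label e == 0)) h
 & supp (fun e => simplex nverts 3 e && (cobd edge_label e == 0)) t].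

Lemma negligible_subgroup : subgroup negligible.
Proof.
split=> [|f1 f2 [h1 [t1 [-> hs1 ts1]]] [h2 [t2 [-> hs2 ts2]]]].
  by exists 0, 0; split; rewrite ?simp_bd0 ?addr0 // => e; rewrite eqxx.
exists (h1 - h2), (t1 - t2); split; [|exact: suppB|exact: suppB].
by rewrite simp_bdB opprD addrACA.
Qed.
Local Notation NS := negligible_subgroup.

Lemma negligible_edge p q : label p q = 0 -> negligible (edge p q).
Proof.
move=> pq0; exists (edge p q), 0; split; last by move=> e; rewrite eqxx.
  by rewrite simp_bd0 addr0.
move=> e; rewrite /edge; case: andP => // -[/eqP se /eqP me] _.
by rewrite /simplex se -(size_mask se) me /edge_label me pq0 !eqxx.
Qed.

Lemma negligible_triangle p q r : subseq [:: p; q; r] verts ->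
  label q r - label p r + label p q = 0 ->
  negligible (edge q r - edge p r + edge p q).
Proof.
case/subseqP => c sc mc cyc.
pose t := (fun u => (u == c)%:R : int).
have cc : count id c = 3%N by rewrite -(size_mask sc) -mc.
have ts : supp (simplex nverts 3) t.
  by move=> u; rewrite /t; case: (u =P c) => [-> _|_]; rewrite ?eqxx // /simplex sc cc !eqxx.
exists 0, (- t); split; first last.
- move=> u; rewrite ?funE /t; case: (u =P c) => [-> _|_]; last by rewrite oppr0 eqxx.
  rewrite /simplex sc cc !eqxx /=.
  rewrite (cobd_mask (fun m : seq V => if m is [:: p; q] then label p q else 0)) // -mc /=.
  rewrite expr0 expr1 sqrrN expr1n !mulr1z mulrN1z opprK sub0r.
  by rewrite [- _ + _]addrC addrAC -[label p r - _]opprB -opprD cyc oppr0.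
- by move=> u; rewrite eqxx.
rewrite add0r simp_bdN; apply/funext => e; rewrite ?funE.
have [se|se] := eqVneq (size e) nverts; last first.
  rewrite !edge_out // subr0 addr0; apply/esym/eqP; rewrite oppr_eq0.
  by apply: contraNT se => /(simp_bd_simplex ts) /andP[].
rewrite (simp_bd_delta uniq_verts sc se) -mc /= /edge se eqxx /=.
rewrite expr0 expr1 sqrrN expr1n !mulr1z mulrN1z.
lia.
Qed.

Definition base x := edge VO (VM x).
Definition equiv f g := negligible (f - g).

(** In a triangle with a side labelled [0] the other two sides are identified. *)
Lemma edge_equiv_r p q r : subseq [:: p; q; r] verts -> label q r = 0 ->
  label p r = label p q -> equiv (edge p r) (edge p q).
Proof.
move=> s qr pr; have := negligible_triangle s.
rewrite qr pr sub0r addNr => /(_ erefl) h.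
have := subgroupB NS (negligible_edge qr) h.
by rewrite opprD opprB addrA [_ + (_ - _)]addrC subrK.
Qed.

Lemma edge_equiv_l p q r : subseq [:: p; q; r] verts -> label p q = 0 ->
  label q r = label p r -> equiv (edge q r) (edge p r).
Proof.
move=> s pq qr; have := negligible_triangle s.
rewrite pq qr subrr addr0 => /(_ erefl) h.
by have := subgroupB NS h (negligible_edge pq); rewrite addrK.
Qed.

Lemma subseq_verts (s0 s1 s2 s3 s4 : seq V) :
  subseq s0 [:: VO] -> subseq s1 (map (@VM I) (enum I)) -> subseq s2 [:: VU] ->
  subseq s3 (map (@VN I) (enum I)) ->
  subseq s4 [seq VR t.1.1 t.1.2 t.2 | t <- enum {: I * I * I}] ->
  subseq (s0 ++ s1 ++ s2 ++ s3 ++ s4) verts.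
Proof. by move=> *; do 4! [apply: cat_subseq => //]. Qed.

Lemma edge_VO_VN x : equiv (edge VO (VN x)) (base x).
Proof.
apply: edge_equiv_r => //.
by apply: (@subseq_verts [:: VO] [:: VM x] [::] [:: VN x] [::]);
  rewrite ?sub0seq ?sub1seq ?mem_VM ?mem_VN ?mem_VR ?mem_head.
Qed.

Lemma edge_VU_VN x : equiv (edge VU (VN x)) (base x).
Proof.
apply: (subgroup_trans NS) (edge_VO_VN x); apply: edge_equiv_l => //.
by apply: (@subseq_verts [:: VO] [::] [:: VU] [:: VN x] [::]);
  rewrite ?sub0seq ?sub1seq ?mem_VM ?mem_VN ?mem_VR ?mem_head.
Qed.

Lemma edge_VO_VR x y z : equiv (edge VO (VR x y z)) (base z).
Proof.
apply: (subgroup_trans NS) (edge_VO_VN z); apply: edge_equiv_r => //.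
by apply: (@subseq_verts [:: VO] [::] [::] [:: VN z] [:: VR x y z]);
  rewrite ?sub0seq ?sub1seq ?mem_VM ?mem_VN ?mem_VR ?mem_head.
Qed.

Lemma edge_VU_VR x y z : equiv (edge VU (VR x y z)) (base y).
Proof.
apply: (subgroup_trans NS) (edge_VU_VN y); apply: edge_equiv_r => //.
by apply: (@subseq_verts [::] [::] [:: VU] [:: VN y] [:: VR x y z]);
  rewrite ?sub0seq ?sub1seq ?mem_VM ?mem_VN ?mem_VR ?mem_head.
Qed.

Lemma edge_VM_VR x y z : equiv (edge (VM x) (VR x y z)) (base y).
Proof.
apply: (subgroup_trans NS) (edge_VU_VR x y z); apply: (subgroup_sym NS).
apply: edge_equiv_l => //=; last by rewrite eqxx.
by apply: (@subseq_verts [::] [:: VM x] [:: VU] [::] [:: VR x y z]);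
  rewrite ?sub0seq ?sub1seq ?mem_VM ?mem_VN ?mem_VR ?mem_head.
Qed.

(** The triangle on [VO], [VM x] and [VR x y z]; its sides are identified with
generators by the five lemmas above. *)
Lemma base_additive x y z : v x + v y = v z -> negligible (base x + base y - base z).
Proof.
move=> xyz.
have s : subseq [:: VO; VM x; VR x y z] verts.
  by apply: (@subseq_verts [:: VO] [:: VM x] [::] [::] [:: VR x y z]);
    rewrite ?sub0seq ?sub1seq ?mem_VM ?mem_VN ?mem_VR ?mem_head.
have := negligible_triangle s; rewrite /= eqxx -xyz => h.
have {}h : negligible (edge (VM x) (VR x y z) - edge VO (VR x y z) + base x).
  by apply: h; rewrite [v x + _]addrC opprD addrA subrr sub0r addNr.
have -> : base x + base y - base z =
    (edge (VM x) (VR x y z) - edge VO (VR x y z) + base x)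
    + (base y - edge (VM x) (VR x y z)) + (edge VO (VR x y z) - base z).
  by apply/funext => e; rewrite ?funE; lia.
apply: (subgroupD NS) (edge_VO_VR x y z); apply: (subgroupD NS) => //.
exact: (subgroup_sym NS) (edge_VM_VR x y z).
Qed.

Hypothesis v_pres : additively_presented v.

(** [a] and [f] are the same combination of generators, in [A] and modulo
negligible chains.  As all relations between the generators hold modulo
negligible chains, [f] is negligible when it is tracked by [0]. *)
Definition tracked a f : Prop :=
  exists2 c : I -> int, a = \sum_x v x *~ c x & equiv f (\sum_x base x *~ c x).

Lemma tracked0 f : negligible f -> tracked 0 f.
Proof.
exists (fun _ => 0); first by rewrite big1.
by rewrite /equiv big1 // subr0.
Qed.

Lemma tracked_base x f : equiv f (base x) -> tracked (v x) f.
Proof.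
have sumd (B : zmodType) (F : I -> B) : \sum_y F y *~ (x == y)%:R = F x.
  rewrite (bigD1 x) //= eqxx big1 ?addr0 // => y.
  by rewrite eq_sym => /negbTE ->.
by exists (fun y => (x == y)%:R); rewrite sumd.
Qed.

Lemma trackedD a1 f1 a2 f2 : tracked a1 f1 -> tracked a2 f2 -> tracked (a1 + a2) (f1 + f2).
Proof.
move=> [c1 -> h1] [c2 -> h2]; exists (fun x => c1 x + c2 x).
  by rewrite -big_split; apply: eq_bigr => x _; rewrite mulrzDr.
have := subgroupD NS h1 h2; rewrite /equiv addrACA -opprD.
by under [in X in _ -> X]eq_bigr do rewrite mulrzDr; rewrite big_split.
Qed.

Lemma trackedMz a f m : tracked a f -> tracked (a *~ m) (f *~ m).
Proof.
move=> [c -> h]; exists (fun x => c x * m).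
  by rewrite mulrz_suml; apply: eq_bigr => x _; rewrite mulrzA.
have := subgroupMz NS m h; rewrite /equiv mulrzBl mulrz_suml.
by under [in X in _ -> X]eq_bigr do rewrite mulrzA.
Qed.

Lemma tracked_edge p q : tracked (label p q) (edge p q).
Proof.
case: p q => [|x||x|x y z] [|x'||x'|x' y' z'] /=;
  try (by apply: tracked0; apply: negligible_edge).
- by apply: tracked_base; rewrite /equiv subrr; exact: NS.1.
- exact/tracked_base/edge_VO_VN.
- exact/tracked_base/edge_VO_VR.
- case: eqP => [<-|ne]; first exact/tracked_base/edge_VM_VR.
  by apply/tracked0/negligible_edge; rewrite /= (introF eqP ne).
- exact/tracked_base/edge_VU_VN.
- exact/tracked_base/edge_VU_VR.
Qed.

Lemma tracked_pairing g : supp (simplex nverts 2) g ->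
  tracked (pairing nverts edge_label g) g.
Proof.
move=> gs.
have gE : g = \sum_(e <- codes bool nverts) (fun u => (u == e)%:R : int) *~ g e.
  apply/funext => u; rewrite fct_sumE.
  under eq_bigr do rewrite fun_mulzE -mulrzr intz.
  rewrite sum_codes_delta; case: ifP => // su; apply: suppP0 gs _.
  by rewrite /simplex su.
rewrite [X in tracked _ X]gE /pairing.
elim/big_rec2: _ => [|e f a _ IH]; first by apply: tracked0; exact: NS.1.
apply: trackedD => //; have [->|/gs] := eqVneq (g e) 0.
  by rewrite !mulr0z; apply: tracked0; exact: NS.1.
case/andP=> /eqP se /eqP ce; apply: trackedMz.
have := size_mask se; rewrite ce /edge_label.
case me: (mask e verts) => [|p [|q []]] // _.
by rewrite -(edge_delta se me); exact: tracked_edge.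
Qed.

Lemma graph_presents : presents nverts 1 edge_label.
Proof.
split=> [a|g gs g0].
  have [c ->] := v_pres.1 a; exists (\sum_x base x *~ c x).
    apply: (subgroup_sum (supp_subgroup _)) => x.
    exact/(subgroupMz (supp_subgroup _))/edge_simplex.
  rewrite pairing_sum; apply: eq_bigr => x _; rewrite pairingMz; congr (_ *~ _).
  have : subseq [:: VO; VM x] verts.
    by apply: (@subseq_verts [:: VO] [:: VM x] [::] [::] [::]);
      rewrite ?sub0seq ?sub1seq ?mem_VM ?mem_head.
  case/subseqP => e se me.
  by rewrite /base (edge_delta se (esym me)) pairing_delta // /edge_label -me.
have [c c0 [h [t [hE hs ts]]]] := tracked_pairing gs.
rewrite g0 in c0.
have [h' [t' [hE' hs' ts']]] := v_pres.2 _ _ base NS base_additive c (esym c0).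
exists (h + h'), (t + t'); split.
- by rewrite simp_bdD addrACA -hE -hE' subrK.
- exact: (subgroupD (supp_subgroup _)).
- exact: (subgroupD (supp_subgroup _)).
Qed.

End LabelledGraph.

Lemma exists_presents (A : zmodType) k : finitely_generated A ->
  exists n (L : seq bool -> A), presents n k.+1 L.
Proof.
move=> /additive_presentation[I [v vP]]; elim: k => [|k [n [L H]]].
  by exists (nverts I), (edge_label v); exact: graph_presents.
by exists n.+1, (extend true L); exact: presents_suspension.
Qed.

(** * Blocks as faces of a cube *)

Section Codes.
Local Open Scope ring_scope.
Local Open Scope quotient_scope.
Variables (Sigma : finType) (a b : Sigma).
Hypotheses (a_neq_b : a <> b) (Sigma_ab : forall c : Sigma, c = a \/ c = b).
Implicit Types (e u : seq (option bool)) (v w l : seq bool) (s t : block Sigma).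

Definition piece (x : bool) : seq Sigma := if x then [:: a; b] else [:: b].
Definition pieces l : seq Sigma := flatten (map piece l).
(** The reversal accounts for codes starting with the last coordinate. *)
Definition word v : seq Sigma := pieces (rev v).

Lemma word_cons x v : word (x :: v) = word v ++ piece x.
Proof. by rewrite /word rev_cons /pieces map_rcons flatten_rcons. Qed.

Lemma a_neqb : (a == b) = false. Proof. exact/eqP. Qed.

Lemma pieces_inj : injective pieces.
Proof.
have ba : b <> a by move=> /esym.
elim=> [|x l IH] [|y l'] //; rewrite /pieces /= ?/(pieces _).
- by case: y.
- by case: x.
by case: x y => -[] /= [] // => /IH ->.
Qed.

Lemma word_inj : injective word.
Proof. by move=> v w /pieces_inj /(can_inj revK). Qed.

Lemma count_pieces l : count_mem b (pieces l) = size l.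
Proof.
elim: l => //= x l IH; rewrite /pieces /= count_cat IH.
by case: x; rewrite /= ?a_neqb eqxx.
Qed.

Lemma count_word v : count_mem b (word v) = size v.
Proof. by rewrite count_pieces size_rev. Qed.

Lemma pieces_split l (y z : seq Sigma) : pieces l = y ++ a :: z ->
  exists l1 l2, [/\ l = l1 ++ true :: l2, y = pieces l1 & z = b :: pieces l2].
Proof.
have ba : b <> a by move=> /esym.
elim: l y => [|x l IH] y; first by case: y.
rewrite /pieces /= -/(pieces l); case: x => /=.
  case: y => [|c y] /= [].
    by move=> <-; exists [::], l.
  move=> <-; case: y => [|d y] /= []; first by move/ba.
  move=> <- /IH[l1 [l2 [-> -> ->]]]; by exists (true :: l1), l2.
case: y => [|c y] /= []; first by move/ba.
move=> <- /IH[l1 [l2 [-> -> ->]]]; by exists (false :: l1), l2.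
Qed.

Fixpoint blk e : block Sigma :=
  match e with
  | [::] => Word [::]
  | None :: e' => Ins (blk e') a [:: b]
  | Some x :: e' => block_cat (blk e') (piece x)
  end.

Fixpoint fill (P : pred nat) e : seq bool :=
  match e with
  | [::] => [::]
  | None :: e' => P (stars e').+1 :: fill P e'
  | Some x :: e' => x :: fill P e'
  end.

Lemma dim_blk e : Defs.dim (blk e) = stars e.
Proof. by elim: e => //= -[x|] e IH; rewrite ?dim_cat /= IH. Qed.

Lemma vertex_blk P e : vertex P (blk e) = word (fill P e).
Proof.
by elim: e => //= -[x|] e IH; rewrite ?vertex_cat /= word_cons IH // dim_blk; case: (P _).
Qed.

Lemma block_catA s (y z : seq Sigma) : block_cat (block_cat s y) z = block_cat s (y ++ z).
Proof. by case: s => [w|s c x] /=; rewrite catA. Qed.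

Lemma block_cat0 s : block_cat s [::] = s.
Proof. by case: s => [w|s c x] /=; rewrite cats0. Qed.

Lemma blk_cat w e : blk (map Some w ++ e) = block_cat (blk e) (word w).
Proof.
by elim: w => [|x w IH] /=; rewrite ?block_cat0 // IH block_catA word_cons.
Qed.

(** Comparing the vertices with and without the last insertion, the number of
[b] shows that the inserted letter is [a]; splitting the larger word at this [a]
shows that it occupies a slot and that the rest of the block ends before that
slot. *)
Lemma blk_surj s n : (forall P, exists2 v, size v = n & vertex P s = word v) ->
  exists2 e, size e = n & s = blk e.
Proof.
elim: s n => [w|s IH c x] n h.
  have [v sv /= ->] := h xpredT; exists (map Some v); first by rewrite size_map.
  by rewrite -[map _ _]cats0 blk_cat.
have h1 P : exists2 v, size v = n & vertex P s ++ c :: x = word v.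
  have [v sv] := h (fun i => (i <= Defs.dim s)%N && P i || (i == (Defs.dim s).+1)).
  rewrite /= eqxx orbT (@eq_vertex _ _ P) => [hv|i /andP[_ li]]; first by exists v.
  by rewrite li (ltn_eqF (li : (i < (Defs.dim s).+1)%N)) orbF.
have [v0 sv0 hv0] : exists2 v, size v = n & vertex xpredT s ++ x = word v.
  have [v sv] := h (fun i => (i <= Defs.dim s)%N).
  rewrite /= ltnn (@eq_vertex _ _ xpredT) => [hv|i /andP[_ li]]; first by exists v.
  by rewrite li.
have [v1 sv1 hv1] := h1 xpredT.
have ca : c = a.
  case: (Sigma_ab c) => // cb; have := count_word v1; have := count_word v0.
  by rewrite -hv0 -hv1 sv0 sv1 !count_cat cb /= eqxx; lia.
subst c.
have [l1 [l2 [hl1 _ xE]]] := pieces_split (esym hv1).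
(* The number of slots to the left of the insertion is the same at all vertices. *)
have [P|e se sE] := IH (n - (size l2).+1)%N.
  have [v sv hv] := h1 P.
  have [l3 [l4 [hl ps]]] := pieces_split (esym hv).
  rewrite xE => -[/pieces_inj l24].
  exists (rev l3); last by rewrite /word revK.
  by rewrite size_rev l24 -sv -(size_rev v) hl size_cat /= addnK.
exists (map Some (rev l2) ++ None :: e).
  rewrite size_cat size_map size_rev /= se.
  have : n = (size l1 + (size l2).+1)%N by rewrite -sv1 -(size_rev v1) hl1 size_cat.
  lia.
by rewrite blk_cat /= sE xE /word revK.
Qed.

Fixpoint face (x : bool) (i : nat) e : seq (option bool) :=
  match e with
  | [::] => [::]
  | None :: e' => if i == (stars e').+1 then Some x :: e' else None :: face x i e'
  | Some y :: e' => Some y :: face x i e'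
  end.

Lemma sub_block_id (P N : pred nat) s :
  (forall i, (i <= Defs.dim s)%N -> P i = false /\ N i = false) -> sub_block P N s = s.
Proof.
elim: s => //= s IH c x h; have [-> ->] := h _ (leqnn _).
by rewrite IH // => i li; apply: h; apply: leqW.
Qed.

Lemma sub_block_cat (P N : pred nat) s y :
  sub_block P N (block_cat s y) = block_cat (sub_block P N s) y.
Proof. by case: s => //= s c x; case: (P _); rewrite /= ?block_catA //;
  case: (N _); rewrite /= ?block_catA. Qed.

Lemma sub_block_upper i e : sub_block (pred1 i) pred0 (blk e) = blk (face true i e).
Proof.
elim: e => //= -[x|] e IH /=; first by rewrite sub_block_cat IH.
rewrite dim_blk eq_sym; case: eqP => [->|_] /=; last by rewrite IH.
by rewrite sub_block_id // dim_blk => j jl; rewrite /= ltn_eqF.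
Qed.

Lemma sub_block_lower i e : sub_block pred0 (pred1 i) (blk e) = blk (face false i e).
Proof.
elim: e => //= -[x|] e IH /=; first by rewrite sub_block_cat IH.
rewrite dim_blk eq_sym; case: eqP => [->|_] /=; last by rewrite IH.
by rewrite sub_block_id // dim_blk => j jl; rewrite /= ltn_eqF.
Qed.

Lemma facet_face x i e : (0 < i <= stars e)%N -> facet (face x i e) e.
Proof.
elim: e => [|[y|] e IH] /=; rewrite ?leqn0; first by lia.
  by rewrite /stars /= add0n => /IH ->; rewrite eqxx.
move=> h; case: eqP => [_|ne] /=; first by rewrite eqxx.
by rewrite IH //; move: h ne; rewrite /stars /= add1n; lia.
Qed.

Lemma face_one x i e : Some true \in e -> Some true \in face x i e.
Proof.
elim: e => // -[y|] e IH; rewrite !inE /=.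
  by case/orP => [/eqP [<-]|/IH h]; rewrite ?inE ?eqxx ?h ?orbT.
by move=> h; case: ifP => _; rewrite in_cons ?h ?IH ?orbT.
Qed.

Lemma cube_bd_delta e u : cube_bd (fun c => (c == e)%:R) u =
  \sum_(1 <= i < (stars e).+1)
     (-1) ^+ i.+1 * ((u == face true i e)%:R - (u == face false i e)%:R).
Proof.
elim: e u => [|x e IH] u.
  rewrite big_geq //; case: u => [|y u] //=.
  rewrite (_ : along _ _ = 0) // cube_bd0 add0r.
  by case: y => [[]|]; rewrite ?mulr0n ?mulr0 ?oppr0.
case: u => [|y u].
  rewrite big_nat big1 // => i /andP[i0 _].
  by case: x => [x|] /=; rewrite ?subrr ?mulr0 //; case: ifP => _; rewrite subrr mulr0.
have yx : along y (fun c => (c == x :: e)%:R : int)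
    = if y == x then fun c => (c == e)%:R else 0.
  by apply/funext => c; rewrite /along eqseq_cons; case: ifP.
rewrite [LHS]/= yx.
case: x yx => [x|] yx; rewrite /stars /= ?add0n ?add1n -/(stars e).
  rewrite (_ : match y with None => _ | _ => _ end = 0) ?addr0; last first.
    by case: y {yx} => [[]|] //; rewrite ?mulr0n ?mulr0 ?oppr0.
  case: eqP => [-> |ne]; first by rewrite IH; apply: eq_bigr => i _; rewrite !eqseq_cons eqxx.
  rewrite cube_bd0 big1 // => i _.
  by rewrite !eqseq_cons (introF eqP ne) subrr mulr0.
rewrite big_nat_recr //= eqxx.
under eq_big_nat => i /andP[_ li] do rewrite (ltn_eqF li).
rewrite !eqseq_cons eqxx /= !exprS mulN1r mulN1r opprK.
case: y {yx} => [y|] /=; last first.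
  rewrite subrr mulr0; congr (_ + _); rewrite IH.
  by apply: eq_bigr => i _; rewrite !eqseq_cons eqxx.
rewrite cube_bd0 big1 ?add0r => [|i _]; last by rewrite oppr0 mulr0.
case: (u =P e) => [->|_].
  by case: y => /=; rewrite ?subr0 ?sub0r ?mulr1 ?mulrN1.
by case: y => /=; rewrite subrr !mulr0 ?oppr0.
Qed.

(** All insertions are of [a] and are followed by [b], which makes the block
canonical and separated. *)
Fixpoint good_block s : bool :=
  if s is Ins t c x then [&& c == a, ohead x == Some b & good_block t] else true.

Lemma good_blk e : good_block (blk e).
Proof.
elim: e => // -[x|] e IH /=; last by rewrite !eqxx.
by case: (blk e) IH => //= s c [|d y] /=; rewrite ?andbF.
Qed.

Lemma good_canonical s : good_block s -> Defs.canonical s && separated s.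
Proof.
elim: s => //= t IH c x /and3P[/eqP -> /eqP -> gt].
have /andP[-> ->] := IH gt; rewrite /= (_ : _ != _ = true); last first.
  by apply/eqP => -[] /esym.
by case: t gt {IH} => //= t' d [|? ?] //=; rewrite andbF.
Qed.

Local Notation cls e := (\pi_(block_class Sigma) (blk e)).

Lemma valid_blk e : valid (cls e).
Proof.
by have /andP[cs ss] := good_canonical (good_blk e); rewrite valid_pi canon_id.
Qed.

Lemma fill_top e : fill xpredT e = top e.
Proof. by elim: e => //= -[[]|] e ->. Qed.

Lemma fill_bot e : fill xpred0 e = [seq x == Some true | x <- e].
Proof. by elim: e => //= -[[]|] e ->. Qed.

Lemma vle_fill P e : vle (fill P e) (top e).
Proof. by elim: e => //= -[[]|] e h; rewrite /vle /= -/(vle _ _) h ?implybT. Qed.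

Lemma blk_pi_inj e u : cls e = cls u -> e = u.
Proof.
move/block_class_eqP/block_equivP => [_ h].
have hf P : fill P e = fill P u by apply: word_inj; rewrite -!vertex_blk.
have := hf xpred0; have := hf xpredT; rewrite !fill_top !fill_bot.
by elim: e u {h hf} => [|x e IH] [|y u] //= [h1 /IH h2] [h3 /h2 ->]; case: x y h1 h3 => [[]|] [[]|].
Qed.

Section InComplex.
Variables (A : zmodType) (N k : nat) (L : seq bool -> A).

Definition vertex_words : set (seq Sigma) :=
  [set word v | v in [set v | in_K N k L v /\ true \in v]]%classic.

Lemma finite_vertex_words : finite_set vertex_words.
Proof.
apply: finite_image; apply: sub_finite_set (finite_seq (codes bool N)).
by move=> v [/andP[sv _] _] /=; rewrite mem_codes.
Qed.

Lemma in_complex_blk j e :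
  in_complex vertex_words j (cls e) = sub_cell N k L j e.
Proof.
rewrite /in_complex valid_blk class_dim_pi dim_blk andTb /sub_cell /cone_cell -andbA.
congr (_ && _); apply/asboolP/andP; rewrite vertices_pi.
  move=> h; split.
    have [|v [Kv _]] := h (word (top e)); last by move/word_inj <-.
    by exists xpredT => //; rewrite vertex_blk fill_top.
  have [|v [_ v1]] := h (word (fill xpred0 e)); first by exists xpred0 => //; rewrite vertex_blk.
  move/word_inj => vE; move: v1; rewrite vE fill_bot => /mapP[x xe /esym/eqP xE].
  by rewrite -xE.
move=> [Ke e1] _ [P _ <-]; rewrite vertex_blk; exists (fill P e) => //; split.
  exact: in_K_vle (vle_fill P e) Ke.
elim: e e1 {Ke} => // -[x|] e IH /=; rewrite !inE.
  by case/orP => [/eqP [<-]|/IH ->]; rewrite ?orbT.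
by move=> /= /IH ->; rewrite orbT.
Qed.

Lemma in_complex_code j q : in_complex vertex_words j q ->
  exists2 e, sub_cell N k L j e & q = cls e.
Proof.
move=> h; have /and3P[_ _ /asboolP Vq] := h.
have [|e se sE] := @blk_surj (repr q) N.
  move=> P; have [v [/andP[/eqP sv _] _] <-] : vertex_words (vertex P (repr q)).
    by apply: Vq; exists P.
  by exists v.
have qE : q = cls e by rewrite -sE reprK.
by exists e; rewrite // -in_complex_blk -qE.
Qed.

Local Notation W := vertex_words.

(** The coefficients of a chain, as a function on codes.  Injectivity of [blk] on
codes and [blk_surj] make this an isomorphism onto the chains of cubes in the
complex. *)
Definition code_chain j (z : chain W j) : seq (option bool) -> int :=
  fun e => if insub (cls e) is Some c then coeff (c : cell W j) z else 0.

Lemma code_chainB j (z1 z2 : chain W j) :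
  code_chain (z1 - z2) = code_chain z1 - code_chain z2.
Proof.
apply/funext => e; rewrite ?funE /code_chain; case: insubP => [c _ _|_]; last by rewrite subr0.
exact: coeffB.
Qed.

Lemma code_chain0 j : code_chain (0 : chain W j) = 0.
Proof. by rewrite -[X in code_chain X](subrr 0) code_chainB subrr. Qed.

Lemma code_chainN j (z : chain W j) : code_chain (- z) = - code_chain z.
Proof. by rewrite -[- z]sub0r code_chainB code_chain0 sub0r. Qed.

Lemma code_chainD j (z1 z2 : chain W j) :
  code_chain (z1 + z2) = code_chain z1 + code_chain z2.
Proof. by rewrite -[z2 in LHS]opprK code_chainB code_chainN opprK. Qed.

Lemma code_chain_sum j (I : Type) (r : seq I) (F : I -> chain W j) :
  code_chain (\sum_(i <- r) F i) = \sum_(i <- r) code_chain (F i).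
Proof.
elim/big_rec2: _ => [|i y1 y2 _ IH]; first exact: code_chain0.
by rewrite code_chainD IH.
Qed.

Lemma code_chainZ j m (z : chain W j) : code_chain (m *: z) = code_chain z *~ m.
Proof.
apply/funext => e; rewrite fun_mulzE /code_chain; case: insubP => [c _ _|_].
  by rewrite coeffZ -[RHS]mulrzr intz mulrC.
by rewrite mul0rz.
Qed.

Lemma code_chain_supp j (z : chain W j) : supp (sub_cell N k L j) (code_chain z).
Proof.
move=> e; rewrite /code_chain; case: insubP => [c ce _ _|]; last by rewrite eqxx.
by rewrite -in_complex_blk.
Qed.

Lemma code_chain_inj j : injective (@code_chain j).
Proof.
move=> z1 z2 h; apply/eqP/freeg_eqP => c.
have [e ec ce] := in_complex_code (valP c).
have := congr1 (fun F => F e) h; rewrite /code_chain -ce valK; exact.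
Qed.

Lemma code_chain_cell j e : sub_cell N k L j e ->
  code_chain (cell_chain W j (cls e)) = (fun u => (u == e)%:R).
Proof.
move=> ej; apply/funext => u; rewrite /cell_chain /code_chain.
have he : in_complex W j (cls e) by rewrite in_complex_blk.
rewrite (insubT (in_complex W j) he).
case: insubP => [c uc cu|].
  rewrite coeffU mul1r -val_eqE /= cu; congr (nat_of_bool _)%:R.
  by apply/eqP/eqP => [/blk_pi_inj ->|-> //].
by rewrite in_complex_blk; case: (u =P e) => // ->; rewrite ej.
Qed.

Lemma code_chain_surj j f : supp (sub_cell N k L j) f ->
  exists z : chain W j, code_chain z = f.
Proof.
move=> fs; exists (\sum_(e <- codes (option bool) N) f e *: cell_chain W j (cls e)).
rewrite code_chain_sum; apply/funext => u; rewrite fct_sumE.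
transitivity (\sum_(e <- codes (option bool) N) (u == e)%:R * f e).
  apply: eq_bigr => e _; rewrite code_chainZ fun_mulzE -mulrzr intz.
  have [->|/fs fe] := eqVneq (f e) 0; first by rewrite !mulr0.
  by rewrite code_chain_cell.
rewrite sum_codes_delta; case: ifP => // su; apply/esym; apply: suppP0 fs _.
by rewrite /sub_cell /cone_cell /in_K size_map su /= andbF.
Qed.

Lemma code_chain_bd j (z : chain W j) : code_chain (boundary z) = cube_bd (code_chain z).
Proof.
rewrite -[z]freeg_sumE; elim: (dom z) => [|c r IH].
  by rewrite big_nil raddf0 !code_chain0 cube_bd0.
rewrite big_cons raddfD /= !code_chainD cube_bdD -{}IH; congr (_ + _).
move: (coeff c z) => m {z r}.
rewrite (_ : boundary << m *g c >> = m *: boundary_cell c); last exact: liftU.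
have -> : << m *g c >> = m *: << c >> :> chain W j.
  by apply/eqP/freeg_eqP => d; rewrite coeffZ !coeffU mul1r.
have [e ec ce] := in_complex_code (valP c).
have se : stars e = j by case/andP: ec => /andP[/eqP].
have cE : << c >> = cell_chain W j (cls e).
  by rewrite /cell_chain -ce valK.
have bdZ f n : cube_bd (f *~ n) = cube_bd f *~ n.
  elim/int_ind: n => [|n IHn|n IHn]; first by rewrite !mulr0z cube_bd0.
    by rewrite -addn1 PoszD !mulrzDr cube_bdD IHn.
  by rewrite -addn1 PoszD opprD !mulrzDr cube_bdD IHn !mulrN1z cube_bdN.
rewrite !code_chainZ bdZ cE code_chain_cell //; congr (_ *~ _).
rewrite code_chain_sum; apply/funext => u; rewrite fct_sumE cube_bd_delta se.
apply: eq_big_nat => i ij.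
have faceE x : code_chain (cell_chain W j.-1 (cls (face x i e))) = (fun u => (u == face x i e)%:R).
  apply: code_chain_cell; have fe : facet (face x i e) e by apply: facet_face; rewrite se.
  case/andP: ec => /andP[_ Ke] e1.
  rewrite /sub_cell /cone_cell (in_K_vle (facet_top fe) Ke) face_one // !andbT.
  by rewrite -[j]se (facet_stars fe).
rewrite code_chainZ code_chainB fun_mulzE ?funE ce.
rewrite upper_face_pi lower_face_pi sub_block_upper sub_block_lower !faceE.
by rewrite -mulrzr intz mulrC.
Qed.

End InComplex.
End Codes.

(** * The homology of the insertion chain complex *)

Section Homology.
Local Open Scope ring_scope.
Local Open Scope quotient_scope.

Lemma isomorphic_of (U V : zmodType) (f : U -> V) :
  (forall x y, f (x - y) = f x - f y) -> (forall x, f x = 0 -> x = 0) ->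
  (forall y, exists x, f x = y) -> isomorphic U V.
Proof.
move=> fB f0 fs.
pose F : {additive U -> V} := HB.pack f (GRing.isZmodMorphism.Build U V f fB).
exists F; have [g gK] := choice fs; exists g => // x.
by apply/eqP; rewrite -subr_eq0; apply/eqP/f0; rewrite fB gK subrr.
Qed.

(** A homomorphism on chains that vanishes on boundaries, is injective on cycles
modulo boundaries and is onto on cycles descends to homology. *)
Lemma homology_isomorphic (Sigma : finType) (W : set (seq Sigma)) (k : nat)
  (A : zmodType) (theta : chain W k -> A) :
  (forall z1 z2, theta (z1 - z2) = theta z1 - theta z2) ->
  (forall w : chain W k.+1, theta (boundary w) = 0) ->
  (forall z, boundary z = 0 -> theta z = 0 ->
     exists w : chain W k.+1, boundary w = z) ->
  (forall x, exists2 z, boundary z = 0 & theta z = x) ->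
  isomorphic (homology W k) A.
Proof.
move=> thetaB theta_bd theta_inj theta_surj.
pose H := homology W k.
pose f (q : H) : A := theta (cycle_chain (repr q)).
have fpi (z : cycles W k) : f (\pi_H z) = theta (cycle_chain z).
  apply/eqP; rewrite -subr_eq0 -thetaB.
  have : \pi_H (repr (\pi_H z)) == \pi_H z by rewrite reprK.
  rewrite -Quotient.idealrBE => /asboolP[w wE].
  by rewrite -[_ - _]/(cycle_chain (repr (\pi_H z) - z)) -wE theta_bd.
apply: (@isomorphic_of _ _ f) => [x y|x fx|a].
- rewrite -[x]reprK -[y]reprK -raddfB !fpi; exact: thetaB.
- rewrite -[x]reprK -[RHS](raddf0 \pi_H); apply/eqP; rewrite -Quotient.idealrBE subr0.
  apply/asboolP; have [w wE] := theta_inj (cycle_chain (repr x)) (eqP (valP (repr x))) fx.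
  by exists w.
have [z z0 za] := theta_surj a.
have zc : z \in @is_cycle Sigma W k by apply/eqP.
by exists (\pi_H (Cycle zc)); rewrite fpi.
Qed.

Lemma vertex_words_homology (Sigma : finType) (a b : Sigma) (A : zmodType) n k
  (L : seq bool -> A) : a <> b -> (forall c, c = a \/ c = b) -> (0 < k)%N ->
  presents n k L ->
  isomorphic (homology (vertex_words a b n.+1 k (extend false L)) k) A.
Proof.
move=> ab Sab k0 /presents_cone[surj inj].
pose th z := theta n.+1 (extend false L) (@code_chain _ a b _ n.+1 k (extend false L) k z).
apply: (@homology_isomorphic _ _ _ _ th) => [z1 z2|w|z z0 tz|x].
- by rewrite /th code_chainB thetaB.
- by rewrite /th (code_chain_bd ab Sab w) (@theta_bd _ _ k) //; exact: code_chain_supp.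
- have [||w ws wE] := theta_inj k0 inj (f := code_chain z) _ _ tz.
  + exact: code_chain_supp.
  + by rewrite -(code_chain_bd ab Sab) z0 code_chain0.
  have [c cw] := code_chain_surj ab ws.
  by exists c; apply: (code_chain_inj ab Sab); rewrite (code_chain_bd ab Sab c) cw wE.
have [f [fs f0 fx]] := theta_surj surj x.
have [z zf] := code_chain_surj ab fs.
exists z; last by rewrite /th zf.
by apply: (code_chain_inj ab Sab); rewrite (code_chain_bd ab Sab) zf f0 code_chain0.
Qed.

End Homology.

Theorem theorem5p5 (Sigma : finType) (a b : Sigma)
  (a_neq_b : a <> b) (Sigma_ab : forall c : Sigma, c = a \/ c = b)
  (A : zmodType) (A_fg : finitely_generated A) (k : nat) (k_gt0 : 0 < k) :
  exists W : set (seq Sigma),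
    finite_set W /\ isomorphic (homology W k) A.
Proof.
have [n [L nL]] := exists_presents k.-1 A_fg.
rewrite prednK // in nL.
exists (vertex_words a b n.+1 k (extend false L)); split.
  exact: finite_vertex_words.
exact: vertex_words_homology.
Qed.
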